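(* There exist a geometrically infinite hyperbolic surface $S$ whose injectivity radius is everywhere above some positive constant $C$ (i.e. $\mathrm{Inj}(p)\ge C>0$ for all $p\in S$), and a vector $u$ in the non-wandering set $\Omega_h\subset T^1S$ of the horocycle flow $h_{\mathbb{R}}$, satisfying: (i) $u(\mathbb{R}^+)$ is almost minimizing; (ii) $g_{\mathbb{R}^+}u \subset \overline{h_{\mathbb{R}}u}$; (iii) $\underline{\mathrm{Inj}}(u(\mathbb{R}^+)) < +\infty$. In particular, $h_{\mathbb{R}}u$ is not locally closed.
   Context: A hyperbolic surface here is a quotient $S=\Gamma\backslash\mathbb{H}^2$ of the hyperbolic plane $\mathbb{H}^2$ (upper half-plane model) by a Fuchsian group $\Gamma$ (discrete subgroup of $\mathrm{PSL}_2(\mathbb{R})$) without elliptic elements; $T^1S := \Gamma\backslash(T^1\mathbb{H}^2)$. The surface $S$ is geometrically finite if its fundamental group is finitely generated, and geometrically infinite otherwise. $g_{\mathbb{R}}$ denotes the geodesic flow and $h_{\mathbb{R}}$ the horocycle flow, on $T^1\mathbb{H}^2$ and, by descent, on $T^1S$. For $\tilde u\in T^1\mathbb{H}^2$, $\tilde u^+\in\partial\mathbb{H}^2=\mathbb{R}\cup\{\infty\}$ is the endpoint of the half-geodesic $\{g_t\tilde u\}_{t\ge 0}$; the orbit $h_{\mathbb{R}}\tilde u$ consists of the unit vectors based on the horocycle centered at $\tilde u^+$ through the base point of $\tilde u$, and pointing towards $\tilde u^+$ (unit-speed parametrization of the horocycle). For $u\in T^1S$, $u(t)\in S$ denotes the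 base point of $g_tu$, and $u(\mathbb{R}^+)=\{u(t): t\ge 0\}$ is the corresponding half-geodesic; $g_{\mathbb{R}^+}u=\{g_tu : t\geq 0\}$ and $h_{\mathbb{R}}u=\{h_su : s\in\mathbb{R}\}$. Closures are taken in $T^1S$. The non-wandering set $\Omega_h$ is the set of $u\in T^1S$ such that for every neighborhood $V$ of $u$ there is a sequence $s_n\to+\infty$ with $h_{s_n}V\cap V\neq\emptyset$. The half-geodesic $u(\mathbb{R}^+)$ is almost minimizing if there exists $C'>0$ such that $d(u(0),u(t)) > t-C'$ for all $t>0$, where $d$ is the distance on $S$. For $p\in S$, the injectivity radius is $\mathrm{Inj}(p) := \min_{\gamma\in\Gamma,\ \gamma\neq \mathrm{id}} d(\tilde p,\gamma\tilde p)$, where $\tilde p$ is any lift of $p$ to $\mathbb{H}^2$; and $\underline{\mathrm{Inj}}(u(\mathbb{R}^+)) := \liminf_{t\to+\infty}\mathrm{Inj}(u(t))$. The orbit $h_{\mathbb{R}}u$ is locally closed if there exists a neighborhood $V$ of $u$ in $T^1S$ such that $V\cap(\overline{h_{\mathbb{R}}u}\setminus h_{\mathbb{R}}u)=\emptyset$. *)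

(* Defs.v *)
From HB Require Import structures.
From mathcomp Require Import all_boot all_order all_algebra.
From mathcomp Require Import complex ring lra.
From mathcomp Require Import all_classical all_reals all_analysis.

Set Implicit Arguments.
Unset Strict Implicit.
Unset Printing Implicit Defensive.

Import Order.TTheory GRing.Theory Num.Theory.
Import numFieldNormedType.Exports.

Local Open Scope classical_set_scope.
Local Open Scope ring_scope.
Local Open Scope complex_scope.
Local Open Scope quotient_scope.

Section fundamental_group.
Context {R : realType} {T : topologicalType}.
Implicit Types (p : T) (c : R -> T).

Definition is_loop p c :=
  [/\ {within `[0, 1], continuous c}, c 0 = p & c 1 = p].

Definition homotopic p c c' := exists F : R * R -> T,
  [/\ {within `[0, 1] `*` `[0, 1], continuous F},
      forall t : R, t \in `[0, 1] -> F (0, t) = c t /\ F (1, t) = c' t &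
      forall s : R, s \in `[0, 1] -> F (s, 0) = p /\ F (s, 1) = p].

Definition loop_mul c c' : R -> T :=
  fun t => if t <= 2^-1 then c (2 * t) else c' (2 * t - 1).

Definition loop_inv c : R -> T := fun t => c (1 - t).

(* The loops whose class lies in the subgroup of pi_1(T, p) generated by the
   classes of the loops of A. *)
Inductive pi1_generated p (A : set (R -> T)) : (R -> T) -> Prop :=
| pi1_gen c of A c : pi1_generated p A c
| pi1_one : pi1_generated p A (cst p)
| pi1_mul c c' of pi1_generated p A c & pi1_generated p A c' :
    pi1_generated p A (loop_mul c c')
| pi1_inv c of pi1_generated p A c : pi1_generated p A (loop_inv c)
| pi1_homotopic c c' of pi1_generated p A c & is_loop p c' & homotopic p c c' :
    pi1_generated p A c'.

Definition pi1_finitely_generated p := exists (n : nat) (a : 'I_n -> R -> T),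
  (forall i, is_loop p (a i)) /\
  (forall c, is_loop p c -> pi1_generated p (range a) c).

End fundamental_group.

Section hyperbolic_plane.
Variable R : realType.

Definition SL2 := {M : 'M[R]_2 | \det M == 1}.

Definition hplane := {z : R[i] | 0 < complex.Im z}.

(* A unit tangent vector v at z, |v| / Im z = 1, is encoded as (z, v). *)
Definition unit_hplane :=
  {u : R[i] * R[i] | (0 < complex.Im u.1) && (`|u.2| == (complex.Im u.1)%:C)}.

Definition SL2_val (M : SL2) : 'M[R]_2 := val M.
Definition hplane_coord (z : hplane) : R * R :=
  (complex.Re (val z), complex.Im (val z)).
Definition unit_hplane_coord (u : unit_hplane) : (R * R) * (R * R) :=
  ((complex.Re (val u).1, complex.Im (val u).1),
   (complex.Re (val u).2, complex.Im (val u).2)).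

HB.instance Definition _ := Choice.on SL2.
HB.instance Definition _ := Choice.on hplane.
HB.instance Definition _ := Choice.on unit_hplane.
HB.instance Definition _ := Topological.copy SL2 (initial_topology SL2_val).
HB.instance Definition _ :=
  Topological.copy hplane (initial_topology hplane_coord).
HB.instance Definition _ :=
  Topological.copy unit_hplane (initial_topology unit_hplane_coord).


Definition arcosh (x : R) : R := ln (x + Num.sqrt (x ^+ 2 - 1)).

Definition hdist (z w : hplane) : R :=
  let: (x1, y1) := hplane_coord z in
  let: (x2, y2) := hplane_coord w in
  arcosh (1 + ((x1 - x2) ^+ 2 + (y1 - y2) ^+ 2) / (2 * y1 * y2)).

Lemma SL2_det (M : SL2) : \det (val M) = 1. Proof. exact/eqP/(valP M). Qed.

Fact SL2_one_subproof : \det (1%:M : 'M[R]_2) == 1.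
Proof. by rewrite det1. Qed.
Definition SL2_one : SL2 := Sub 1%:M SL2_one_subproof.

Fact SL2_mul_subproof (M N : SL2) : \det (val M *m val N) == 1.
Proof. by rewrite det_mulmx !SL2_det mulr1. Qed.
Definition SL2_mul (M N : SL2) : SL2 :=
  Sub (val M *m val N) (SL2_mul_subproof M N).

Fact SL2_inv_subproof (M : SL2) : \det (invmx (val M)) == 1.
Proof. by rewrite det_inv SL2_det invr1. Qed.
Definition SL2_inv (M : SL2) : SL2 := Sub (invmx (val M)) (SL2_inv_subproof M).

Fact SL2_opp_subproof (M : SL2) : \det (- val M) == 1.
Proof. by rewrite -scaleN1r detZ sqrrN expr1n mul1r SL2_det. Qed.
Definition SL2_opp (M : SL2) : SL2 := Sub (- val M) (SL2_opp_subproof M).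

Fact SL2_unit (M : SL2) : val M \in unitmx.
Proof. by rewrite unitmxE SL2_det unitr1. Qed.

Fact SL2_mulA : associative SL2_mul.
Proof. by move=> M N P; apply: val_inj; rewrite /= mulmxA. Qed.
Fact SL2_mul1 : left_id SL2_one SL2_mul.
Proof. by move=> M; apply: val_inj; rewrite /= mul1mx. Qed.
Fact SL2_1mul : right_id SL2_one SL2_mul.
Proof. by move=> M; apply: val_inj; rewrite /= mulmx1. Qed.
Fact SL2_mulV : left_inverse SL2_one SL2_inv SL2_mul.
Proof. by move=> M; apply: val_inj; rewrite /= mulVmx ?SL2_unit. Qed.
Fact SL2_Vmul : right_inverse SL2_one SL2_inv SL2_mul.
Proof. by move=> M; apply: val_inj; rewrite /= mulmxV ?SL2_unit. Qed.
HB.instance Definition _ :=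
  isGroup.Build SL2 SL2_mulA SL2_mul1 SL2_1mul SL2_mulV SL2_Vmul.

Definition cocycle (M : 'M[R]_2) (z : R[i]) : R[i] :=
  (M 1 0)%:C * z + (M 1 1)%:C.

Definition mobius (M : 'M[R]_2) (z : R[i]) : R[i] :=
  ((M 0 0)%:C * z + (M 0 1)%:C) / cocycle M z.

Lemma det_mx2 (M : 'M[R]_2) : \det M = M 0 0 * M 1 1 - M 0 1 * M 1 0.
Proof.
rewrite (expand_det_row _ ord0) !big_ord_recl big_ord0 addr0.
rewrite /cofactor !det_mx11 !mxE /= expr0 expr1 mul1r mulN1r mulrN.
by congr (M _ _ * M _ _ - M _ _ * M _ _); exact: val_inj.
Qed.

Lemma mx2P (M N : 'M[R]_2) : M 0 0 = N 0 0 -> M 0 1 = N 0 1 ->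
  M 1 0 = N 1 0 -> M 1 1 = N 1 1 -> M = N.
Proof.
move=> e1 e2 e3 e4; apply/matrixP => i j.
have ord2 (k : 'I_2) : k = 0 \/ k = 1.
  by case: k => -[|[|//]] k2; [left|right]; exact: val_inj.
by case: (ord2 i) => ->; case: (ord2 j) => ->.
Qed.

Lemma normC2 (z : R[i]) :
  `|z| ^+ 2 = (complex.Re z ^+ 2 + complex.Im z ^+ 2)%:C.
Proof.
rewrite normc_def -rmorphXn/= sqr_sqrtr//.
by rewrite addr_ge0 ?sqr_ge0.
Qed.

Lemma cocycle_neq0 (M : SL2) (z : hplane) : cocycle (val M) (val z) != 0.
Proof.
have := SL2_det M; rewrite det_mx2.
case: z => -[x y] /= y0; rewrite /cocycle.
apply: contraPneq => /eqP; simpc; rewrite eq_complex /= => /andP[/eqP e1].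
rewrite mulf_eq0 (gt_eqF y0) orbF => /eqP e2; move: e1.
rewrite e2 mul0r add0r => ->; rewrite !mulr0 subr0 => /eqP.
by rewrite eq_sym oner_eq0.
Qed.

Lemma Im_mobius (M : SL2) (z : hplane) :
  (complex.Im (mobius (val M) (val z)))%:C =
  (complex.Im (val z))%:C / `|cocycle (val M) (val z)| ^+ 2.
Proof.
have := cocycle_neq0 M z; have := SL2_det M; rewrite det_mx2.
rewrite normC2.
case: z => -[x y] /= y0; rewrite /mobius /cocycle.
move: (val M) => {}M dM; simpc => /= j0.
have n0 : (M 1 0 * x + M 1 1) ^+ 2 + (M 1 0 * y) ^+ 2 != 0.
  apply: contra j0; rewrite paddr_eq0 ?sqr_ge0// !sqrf_eq0 => /andP[a b].
  by rewrite eq_complex/= a b.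
rewrite expr0n /= addr0; congr (_ +i* _).
by rewrite -{1}[y in RHS]mul1r -dM; field.
Qed.

Fact mobius_subproof (M : SL2) (z : hplane) :
  0 < complex.Im (mobius (val M) (val z)).
Proof.
rewrite -ltcR Im_mobius divr_gt0 ?ltcR ?(valP z)//.
by rewrite exprn_gt0 ?normr_gt0 ?cocycle_neq0.
Qed.
Definition hact (M : SL2) (z : hplane) : hplane :=
  Sub (mobius (val M) (val z)) (mobius_subproof M z).

Fact foot_subproof (u : unit_hplane) : 0 < complex.Im (val u).1.
Proof. by case/andP: (valP u). Qed.
Definition foot (u : unit_hplane) : hplane := Sub (val u).1 (foot_subproof u).

Lemma norm_unit (u : unit_hplane) :
  `|(val u).2| = (complex.Im (val u).1)%:C.
Proof. by case/andP: (valP u) => _ /eqP. Qed.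

(* The derivative of z |-> M z is 1 / (c z + d) ^ 2. *)
Definition tangent_mobius (M : 'M[R]_2) (u : R[i] * R[i]) : R[i] * R[i] :=
  (mobius M u.1, u.2 / cocycle M u.1 ^+ 2).

Fact tangent_mobius_subproof (M : SL2) (u : unit_hplane) :
  let w := tangent_mobius (val M) (val u) in
  (0 < complex.Im w.1) && (`|w.2| == (complex.Im w.1)%:C).
Proof.
rewrite /= (mobius_subproof M (foot u))/=.
by rewrite (Im_mobius M (foot u)) normf_div normrX norm_unit.
Qed.
Definition tact (M : SL2) (u : unit_hplane) : unit_hplane :=
  Sub (tangent_mobius (val M) (val u)) (tangent_mobius_subproof M u).

Lemma mul_mx2E (M N : 'M[R]_2) i j :
  (M *m N) i j = M i 0 * N 0 j + M i 1 * N 1 j.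
Proof.
rewrite mxE !big_ord_recl big_ord0 addr0.
by congr (M _ _ * N _ _ + M _ _ * N _ _); exact: val_inj.
Qed.

Lemma mobius1 z : mobius 1%:M z = z.
Proof.
by rewrite /mobius /cocycle !mxE /= !rmorph0 !rmorph1 mul0r mul1r addr0 add0r
  divr1.
Qed.

Lemma cocycle1 z : cocycle 1%:M z = 1.
Proof. by rewrite /cocycle !mxE /= rmorph0 rmorph1 mul0r add0r. Qed.

Lemma cocycleM (M N : SL2) (z : hplane) :
  cocycle (val M *m val N) (val z) =
  cocycle (val M) (mobius (val N) (val z)) * cocycle (val N) (val z).
Proof.
have j0 := cocycle_neq0 N z.
rewrite {1 2}/cocycle /mobius !mul_mx2E !rmorphD !rmorphM /=.
by move: j0; rewrite /cocycle /= => j0; field.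
Qed.

Lemma mobiusM (M N : SL2) (z : hplane) :
  mobius (val M *m val N) (val z) = mobius (val M) (mobius (val N) (val z)).
Proof.
have j0 := cocycle_neq0 N z; have j1 := cocycle_neq0 M (hact N z).
rewrite {1}/mobius cocycleM /=; move: j1; rewrite /= => j1.
rewrite {3}/mobius !mul_mx2E !rmorphD !rmorphM /=.
apply: (mulIf (mulf_neq0 j1 j0)); rewrite divfK ?mulf_neq0//.
rewrite mulrA divfK//.
by move: j0; rewrite /cocycle /= => j0; field.
Qed.

Lemma hact1 z : hact 1%g z = z.
Proof. by apply: val_inj; rewrite /= mobius1. Qed.

Lemma hactM (M N : SL2) z : hact (M * N)%g z = hact M (hact N z).
Proof. by apply: val_inj; rewrite /= mobiusM. Qed.

Lemma tact1 u : tact 1%g u = u.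
Proof.
apply: val_inj; rewrite /= /tangent_mobius mobius1 cocycle1 expr1n divr1.
by case: (val u).
Qed.

Lemma tactM (M N : SL2) u : tact (M * N)%g u = tact M (tact N u).
Proof.
apply: val_inj; rewrite /= /tangent_mobius/=.
rewrite (mobiusM M N (foot u)) (cocycleM M N (foot u)) exprMn invfM/=.
by rewrite mulrA [_ / _ / _ in LHS]mulrAC.
Qed.

Lemma foot_tact M u : foot (tact M u) = hact M (foot u).
Proof. exact: val_inj. Qed.

Lemma tactN M u : tact (SL2_opp M) u = tact M u.
Proof.
apply: val_inj; rewrite /= /tangent_mobius /mobius.
have -> z : cocycle (- val M) z = - cocycle (val M) z.
  by rewrite /cocycle !mxE !rmorphN mulNr opprD.
rewrite sqrrN !mxE !rmorphN mulNr -opprD invrN mulrNN.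
by [].
Qed.

Fact up_subproof (x y : R) : 0 < y ->
  (0 < complex.Im (x +i* y)) &&
  (`|(0 +i* y) : R[i]| == (complex.Im (x +i* y))%:C).
Proof.
by move=> y0; rewrite /= y0 normc_def /= expr0n add0r sqrtr_sqr gtr0_norm/=.
Qed.
(* The upward unit vector based at x + i y. *)
Definition up (x y : R) (y0 : 0 < y) : unit_hplane :=
  Sub (x +i* y, 0 +i* y) (up_subproof x y0).

(* [frame u], one of the two opposite matrices mapping the upward unit vector
   (i, i) to u = (z, v), has last row (c, d) with (c i + d) ^ 2 = i / v, and
   first row (a, b) with a i + b = z (c i + d). *)
Definition root_dir (u : unit_hplane) : R[i] := sqrtC ((0 +i* 1) / (val u).2).

Definition frame_mx (u : unit_hplane) : 'M[R]_2 :=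
  let q := root_dir u in let p := (val u).1 * q in
  \matrix_(i, j) (if i == 0 then if j == 0 then complex.Im p else complex.Re p
   else if j == 0 then complex.Im q else complex.Re q).

Lemma root_dir_norm u : `|root_dir u| ^+ 2 = (complex.Im (val u).1)%:C^-1.
Proof.
rewrite -normrX sqrtCK normf_div norm_unit.
by rewrite normc_def /= expr0n expr1n add0r sqrtr1 div1r.
Qed.

Fact frame_subproof u : \det (frame_mx u) == 1.
Proof.
apply/eqP; have := root_dir_norm u; have := foot_subproof u.
rewrite det_mx2 !mxE /= normC2; case: (val u) => -[x y] v /= y0.
case: (root_dir u) => a b /=.
move/(congr1 (fun z => (z * y%:C))); rewrite mulVf; last first.
  by rewrite eq_complex /= gt_eqF.
rewrite -(rmorphM (real_complex R)) => -[].
rewrite /= => <-; ring.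
Qed.
Definition frame u : SL2 := Sub (frame_mx u) (frame_subproof u).

Lemma frameP u : tact (frame u) (up 0 ltr01) = u.
Proof.
have ci : cocycle (frame_mx u) (0 +i* 1) = root_dir u.
  by rewrite /cocycle !mxE /=; simpc; case: (root_dir u).
have q0 : root_dir u != 0.
  by rewrite -ci; exact: (cocycle_neq0 (frame u) (foot (up 0 ltr01))).
apply: val_inj; rewrite /= /tangent_mobius /= /mobius ci.
rewrite [val u]surjective_pairing; congr pair.
  apply: (mulIf q0); rewrite divfK// !mxE /=.
  by simpc; case: ((val u).1 * _).
have v0 : (val u).2 != 0.
  by rewrite -normr_eq0 norm_unit eq_complex /= gt_eqF// foot_subproof.
by rewrite sqrtCK invfM invrK mulrA mulfV ?mul1r// eq_complex /= oner_eq0 andbF.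
Qed.

Lemma tact_up_inj (M N : SL2) (u : unit_hplane) :
  tact M u = tact N u -> M = N \/ M = SL2_opp N.
Proof.
rewrite -(frameP u) -!tactM => e.
suff [e1|e1] : ((N * frame u)^-1 * (M * frame u) = 1 \/
    (N * frame u)^-1 * (M * frame u) = SL2_opp 1)%g.
- left; apply: (mulIg (frame u)).
  by apply: (mulgI (N * frame u)^-1%g); rewrite e1 mulVg.
- right; apply: (mulIg (frame u)).
  apply: (mulgI (N * frame u)^-1%g); rewrite e1.
  apply: val_inj; rewrite /= mulNmx mulmxN mulVmx//.
  exact: (SL2_unit (N * frame u)%g).
have : tact ((N * frame u)^-1 * (M * frame u))%g (up 0 ltr01) = up 0 ltr01.
  by rewrite tactM e -tactM mulVg tact1.
move: (_^-1 * _)%g => P {e} /(congr1 val) e.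
have eP : mobius (val P) (0 +i* 1) = 0 +i* 1 := congr1 fst e.
have eC : (0 +i* 1) / cocycle (val P) (0 +i* 1) ^+ 2 = 0 +i* 1 := congr1 snd e.
have j0 : cocycle (val P) (0 +i* 1) != 0.
  exact: (cocycle_neq0 P (foot (up 0 ltr01))).
have i0 : (0 +i* 1 : R[i]) != 0 by rewrite eq_complex /= oner_eq0 andbF.
have : cocycle (val P) (0 +i* 1) ^+ 2 = 1.
  have {}e := congr1 ( *%R^~ (cocycle (val P) (0 +i* 1) ^+ 2)) eC.
  move: e; rewrite /= divfK ?sqrf_eq0// => e.
  by apply: (mulIf i0); rewrite mul1r [RHS]e mulrC.
move/eqP; rewrite sqrf_eq1 => jE.
have {}eP := canRL (mulfVK j0) eP.
case/orP: jE => /eqP jE; rewrite jE in eP; [left|right];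
  (move: jE; rewrite /cocycle; simpc => /eqP;
   rewrite eq_complex /= ?oppr0 => /andP[/eqP e1 /eqP e2];
   move: eP; simpc => /eqP;
   rewrite eq_complex /= ?oppr0 => /andP[/eqP e3 /eqP e4];
   by apply: val_inj; apply: mx2P; rewrite /= !mxE ?oppr0).
Qed.

(* On H^2, t |-> e^t i is the unit speed geodesic directed by (i, i), ending at
   oo, and s |-> (s + i, i) runs at unit speed through the upward vectors along
   the horocycle Im z = 1 centred at oo; isometries carry these to every u. The
   sign ambiguity of the frame is irrelevant since M and - M act alike. *)
Definition geodesic_lift (t : R) (u : unit_hplane) : unit_hplane :=
  tact (frame u) (up 0 (expR_gt0 t)).

Definition horocycle_lift (s : R) (u : unit_hplane) : unit_hplane :=
  tact (frame u) (up s ltr01).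

Lemma frame_tact M u :
  frame (tact M u) = (M * frame u)%g \/
  frame (tact M u) = SL2_opp (M * frame u)%g.
Proof.
by apply: (@tact_up_inj _ _ (up 0 ltr01)); rewrite frameP tactM frameP.
Qed.

Lemma geodesic_lift_tact t M u :
  geodesic_lift t (tact M u) = tact M (geodesic_lift t u).
Proof.
by rewrite /geodesic_lift; case: (frame_tact M u) => ->; rewrite ?tactN tactM.
Qed.

Lemma horocycle_lift_tact s M u :
  horocycle_lift s (tact M u) = tact M (horocycle_lift s u).
Proof.
by rewrite /horocycle_lift; case: (frame_tact M u) => ->; rewrite ?tactN tactM.
Qed.

End hyperbolic_plane.

(* A Fuchsian group without elliptic elements, as a subgroup of PSL_2(R)
   represented by its full preimage in SL_2(R). *)
Record surface_group (R : realType) := SurfaceGroup {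
  deck :> set (SL2 R);
  deck1 : deck 1%g;
  deckVM : forall M N, deck M -> deck N -> deck (M^-1 * N)%g;
  deckN1 : deck (SL2_opp 1%g);
  deck_discrete : forall M, deck M -> isolated deck M;
  deck_no_elliptic : forall M z, deck M -> hact M z = z ->
    M = 1%g \/ M = SL2_opp 1%g
}.

Section hyperbolic_surface.
Context {R : realType} (G : surface_group R).

Definition same_orbit (X : choiceType) (act : SL2 R -> X -> X) : rel X :=
  fun x y => `[< exists2 M, deck G M & y = act M x >].

Lemma same_orbit_equiv (X : choiceType) (act : SL2 R -> X -> X) :
  (forall x, act 1%g x = x) ->
  (forall M N x, act (M * N)%g x = act M (act N x)) ->
  equiv_class_of (same_orbit act).
Proof.
move=> act1 actM; have GV M : deck G M -> deck G M^-1%g.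
  by move=> GM; rewrite -[M^-1%g]mulg1; exact: (deckVM GM (deck1 G)).
split.
- by move=> x; apply/asboolP; exists 1%g; [exact: deck1|rewrite act1].
- suff sym x y : same_orbit act x y -> same_orbit act y x.
    by move=> x y; apply/idP/idP; exact: sym.
  move=> /asboolP[M GM ->]; apply/asboolP; exists M^-1%g; first exact: GV.
  by rewrite -actM mulVg act1.
- move=> y x z /asboolP[M GM ->] /asboolP[N GN ->]; apply/asboolP.
  exists (N * M)%g; last by rewrite actM.
  by rewrite -[N]invgK; apply: deckVM => //; exact: GV.
Qed.

Definition surface_rel : equiv_rel (hplane R) :=
  EquivRelPack (same_orbit_equiv (@hact1 R) (@hactM R)).
Definition tangent_rel : equiv_rel (unit_hplane R) :=
  EquivRelPack (same_orbit_equiv (@tact1 R) (@tactM R)).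

Definition surface := quotient_topology {eq_quot surface_rel}.
Definition unit_tangent := quotient_topology {eq_quot tangent_rel}.
HB.instance Definition _ := Quotient.on surface.
HB.instance Definition _ := Topological.on surface.
HB.instance Definition _ := Quotient.on unit_tangent.
HB.instance Definition _ := Topological.on unit_tangent.

Definition geometrically_finite :=
  forall p : surface, @pi1_finitely_generated R surface p.

Definition geometrically_infinite := ~ geometrically_finite.

(* The distance induced on the quotient: two points are at the infimum of the
   distances between their lifts. *)
Definition surface_dist (p q : surface) : R :=
  inf [set d | exists z w : hplane R,
    [/\ \pi_surface z = p, \pi_surface w = q & d = hdist z w]].

(* The infimum is a minimum because the group is discrete, it does not depend
   on the lift z of p, and it is +oo when S is the hyperbolic plane itself. *)
Definition inj_radius (p : surface) : \bar R :=
  ereal_inf [set d | exists (z : hplane R) (M : SL2 R),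
    [/\ \pi_surface z = p, deck G M, M <> 1%g, M <> SL2_opp 1%g &
        d = (hdist z (hact M z))%:E]].

Definition base_point (u : unit_tangent) : surface :=
  \pi_surface (foot (repr u)).

Definition geodesic_flow (t : R) (u : unit_tangent) : unit_tangent :=
  \pi_unit_tangent (geodesic_lift t (repr u)).

Definition horocycle_flow (s : R) (u : unit_tangent) : unit_tangent :=
  \pi_unit_tangent (horocycle_lift s (repr u)).

Lemma pi_tact M (u : unit_hplane R) : deck G M ->
  \pi_unit_tangent (tact M u) = \pi_unit_tangent u.
Proof.
by move=> GM; apply/esym/(@eqmodP _ tangent_rel)/asboolP; exists M.
Qed.

Lemma repr_pi_tact (u : unit_hplane R) :
  exists2 M, deck G M & repr (\pi_unit_tangent u) = tact M u.
Proof.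
have : u = repr (\pi_unit_tangent u) %[mod unit_tangent] by rewrite reprK.
by move=> /(@eqmodP _ tangent_rel)/asboolP[M GM]; exists M.
Qed.

Lemma base_point_pi (u : unit_hplane R) :
  base_point (\pi_unit_tangent u) = \pi_surface (foot u).
Proof.
rewrite /base_point; have [M GM ->] := repr_pi_tact u.
by apply/esym/(@eqmodP _ surface_rel)/asboolP; exists M; rewrite ?foot_tact.
Qed.

Lemma geodesic_flow_pi t (u : unit_hplane R) :
  geodesic_flow t (\pi_unit_tangent u) = \pi_unit_tangent (geodesic_lift t u).
Proof.
rewrite /geodesic_flow; have [M GM ->] := repr_pi_tact u.
by rewrite geodesic_lift_tact pi_tact.
Qed.

Lemma horocycle_flow_pi s (u : unit_hplane R) :
  horocycle_flow s (\pi_unit_tangent u) =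
  \pi_unit_tangent (horocycle_lift s u).
Proof.
rewrite /horocycle_flow; have [M GM ->] := repr_pi_tact u.
by rewrite horocycle_lift_tact pi_tact.
Qed.

Definition horocycle_orbit (u : unit_tangent) : set unit_tangent :=
  range (horocycle_flow^~ u).

Definition geodesic_ray (u : unit_tangent) : set unit_tangent :=
  [set geodesic_flow t u | t in [set t | 0 <= t]].

Definition nonwandering : set unit_tangent :=
  [set u | forall V, nbhs u V -> exists s : nat -> R,
    s n @[n --> \oo] --> +oo /\
    forall n, (horocycle_flow (s n) @` V) `&` V !=set0].

Definition almost_minimizing (u : unit_tangent) := exists2 C' : R, 0 < C' &
  forall t, 0 < t ->
    t - C' < surface_dist (base_point u) (base_point (geodesic_flow t u)).

Definition ray_inj_radius (u : unit_tangent) : \bar R :=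
  limf_einf (fun t : R => inj_radius (base_point (geodesic_flow t u))) +oo.

Definition locally_closed_orbit (u : unit_tangent) := exists2 V, nbhs u V &
  V `&` (closure (horocycle_orbit u) `\` horocycle_orbit u) = set0.

End hyperbolic_surface.

(* Main.v *)
Require Import Defs.
From mathcomp Require Import all_boot all_order all_algebra.
From mathcomp Require Import complex ring lra.
From mathcomp Require Import all_classical all_reals all_analysis.

(** The surface is the quotient of the hyperbolic plane by an explicit
infinitely generated Schottky group G, and u is the image of the upward unit
vector at i, so that its half-geodesic is the imaginary axis run towards oo.

Horocycle orbits are orbits of vectors. Multiplying a matrix on the right by
the shear by s slides the corresponding unit vector along its horocycle and
keeps the first column (a, c). Hence the horocycle through u comes close to
g_t u in the quotient as soon as some element of G has its first column close
to (e^(t/2), 0): the shear by s = - b / a turns that element into a matrix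
close to diag(e^(t/2), e^(-t/2)) ([horocycle_approx]). On the other hand
Im (M i) = 1 / (c^2 + d^2), so that the half-geodesic of u is almost minimizing
if the second row (c, d) stays away from 0 on G.

The n-th generator has first column (a_n, c_n) and d = 4. The dilations a_n > 1
run densely through [1, +oo[, and the rates c_n tend to 0 quickly. Since c_n
decreases fast, the intervals of the real line that the generators and their
inverses contract into are disjoint and at very different scales, and the
generators play ping-pong on them ([ping_pong]). On an admissible point a
generator multiplies the second coordinate of vectors by at least 3 and its
inverse by at least 1; the second bound is what the inequality a_n > 1
provides. Three facts about G follow.
- Every element has |d| >= 1 ([word_ed_ge1]). So Im (M i) <= 1 on G and the
  half-geodesic of u even realizes distances.
- Every element other than 1 and -1 has |trace| >= 3 ([trace_word]). This
  gives discreteness, excludes elliptic elements, and bounds the displacement of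
  every point from below, because the squared trace minus 4 is at most
  2 (cosh d (z, M z) - 1) ([sep_trace]).
- No generator is a word in the previous ones ([word_gen_independent]).

The remaining properties of u are read off the generators. First columns
accumulate at every (l, 0) with l >= 1, whence the half-orbit of the geodesic
flow lies in the closure of the horocycle, and, for l = 1, u is non-wandering.
The n-th generator moves the point i / c_n by a distance that only depends on
a_n, so the injectivity radius stays bounded along the sequence of these points
for which a_n < 2. For small t > 0 the vector g_t u is near u and in the
closure of the horocycle, but it is not on the horocycle: an element of G with
first column (e^(t/2), 0) would have |d| = e^(-t/2) < 1. So the horocycle is
not locally closed.

Finally, finitely many loops lift to paths whose ends are translates of the
origin by words in the first N generators. This property is inherited by
all loops in the subgroup of the fundamental group that they generate, and it
fails for the loop of the N-th generator
([not_pi1_finitely_generated]). *)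

Set Implicit Arguments.
Unset Strict Implicit.
Unset Printing Implicit Defensive.

Import Order.TTheory GRing.Theory Num.Theory.
Import numFieldNormedType.Exports.

Local Open Scope classical_set_scope.
Local Open Scope ring_scope.

(** * Matrices of determinant 1 *)
Local Notation ea M := (SL2_val M 0 0).
Local Notation eb M := (SL2_val M 0 1).
Local Notation ec M := (SL2_val M 1 0).
Local Notation ed M := (SL2_val M 1 1).

Section SL2_entries.
Context {R : realType}.
Implicit Types M N : SL2 R.

Lemma SL2_detE M : ea M * ed M - eb M * ec M = 1.
Proof. by rewrite -det_mx2 SL2_det. Qed.

Lemma SL2P M N : ea M = ea N -> eb M = eb N -> ec M = ec N -> ed M = ed N ->
  M = N.
Proof. by move=> *; apply: val_inj; apply: mx2P. Qed.

Definition mx2 (a b c d : R) : 'M[R]_2 := \matrix_(i, j)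
  if i == 0 then (if j == 0 then a else b) else if j == 0 then c else d.

Fact SL2_of_subproof (a b c d : R) :
  a * d - b * c = 1 -> \det (mx2 a b c d) == 1.
Proof. by move=> e; rewrite det_mx2 !mxE /= e. Qed.
Definition SL2_of a b c d (e : a * d - b * c = 1) : SL2 R :=
  Sub (mx2 a b c d) (SL2_of_subproof e).

Lemma SL2_ofE a b c d (e : a * d - b * c = 1) :
  let M := SL2_of e in [/\ ea M = a, eb M = b, ec M = c & ed M = d].
Proof. by rewrite /SL2_of /SL2_val /=; split; rewrite !mxE. Qed.

Lemma SL2_mulE M N :
  [/\ ea (M * N)%g = ea M * ea N + eb M * ec N,
      eb (M * N)%g = ea M * eb N + eb M * ed N,
      ec (M * N)%g = ec M * ea N + ed M * ec N &
      ed (M * N)%g = ec M * eb N + ed M * ed N].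
Proof. by split; exact: mul_mx2E. Qed.

Lemma SL2_1E : [/\ ea (1%g : SL2 R) = 1, eb (1%g : SL2 R) = 0,
  ec (1%g : SL2 R) = 0 & ed (1%g : SL2 R) = 1].
Proof. by rewrite /SL2_val /=; split; rewrite !mxE. Qed.

Lemma SL2_oppE M :
  [/\ ea (SL2_opp M) = - ea M, eb (SL2_opp M) = - eb M,
      ec (SL2_opp M) = - ec M & ed (SL2_opp M) = - ed M].
Proof. by rewrite /SL2_val /=; split; rewrite !mxE. Qed.

Lemma SL2_invE M :
  [/\ ea M^-1%g = ed M, eb M^-1%g = - eb M,
      ec M^-1%g = - ec M & ed M^-1%g = ea M].
Proof.
have e : ed M * ea M - (- eb M) * (- ec M) = 1.
  by rewrite -(SL2_detE M); ring.
suff -> : (M^-1)%g = SL2_of e by exact: SL2_ofE.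
apply: (mulIg M); rewrite mulVg.
have [h1 h2 h3 h4] := SL2_ofE e; have [] := SL2_mulE (SL2_of e) M.
rewrite h1 h2 h3 h4 => k1 k2 k3 k4; have [l1 l2 l3 l4] := SL2_1E.
have := SL2_detE M.
by move=> dM; apply: SL2P; rewrite ?k1 ?k2 ?k3 ?k4 ?l1 ?l2 ?l3 ?l4 -?dM; ring.
Qed.

Lemma SL2_oppK : involutive (@SL2_opp R).
Proof. by move=> M; apply: val_inj; rewrite /= opprK. Qed.

Lemma SL2_oppMl M N : (SL2_opp M * N)%g = SL2_opp (M * N)%g.
Proof. by apply: val_inj; rewrite /= mulNmx. Qed.

Lemma SL2_oppMr M N : (M * SL2_opp N)%g = SL2_opp (M * N)%g.
Proof. by apply: val_inj; rewrite /= mulmxN. Qed.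

Lemma SL2_oppV M : ((SL2_opp M)^-1 = SL2_opp M^-1)%g.
Proof.
have [a1 a2 a3 a4] := SL2_invE (SL2_opp M); have [b1 b2 b3 b4] := SL2_oppE M.
have [c1 c2 c3 c4] := SL2_oppE M^-1%g; have [d1 d2 d3 d4] := SL2_invE M.
by apply: SL2P; rewrite ?a1 ?a2 ?a3 ?a4 ?b1 ?b2 ?b3 ?b4 ?c1 ?c2 ?c3 ?c4 ?d1 ?d2
  ?d3 ?d4.
Qed.

Definition tr2 M := ea M + ed M.

Lemma tr2V M : tr2 M^-1%g = tr2 M.
Proof. by rewrite /tr2; have [-> _ _ ->] := SL2_invE M; rewrite addrC. Qed.

Lemma tr2N M : tr2 (SL2_opp M) = - tr2 M.
Proof. by rewrite /tr2; have [-> _ _ ->] := SL2_oppE M; rewrite opprD. Qed.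

Lemma tr2C M N : tr2 (M * N)%g = tr2 (N * M)%g.
Proof.
rewrite /tr2; have [-> _ _ ->] := SL2_mulE M N.
by have [-> _ _ ->] := SL2_mulE N M; ring.
Qed.

Lemma tr2_1 : tr2 1%g = 2.
Proof. by rewrite /tr2; have [-> _ _ ->] := SL2_1E; ring. Qed.

Definition vact M (v : R * R) : R * R :=
  (ea M * v.1 + eb M * v.2, ec M * v.1 + ed M * v.2).

Lemma vactM M N v : vact (M * N)%g v = vact M (vact N v).
Proof.
case: v => p q; rewrite /vact /=; have [-> -> -> ->] := SL2_mulE M N.
by congr pair; ring.
Qed.

(** The matrix has a fixed point in the segment, and c x + d is the
corresponding eigenvalue, so the bound is expected. Here is an argument on the
ends of the segment: with p and q the values of c x + d at the two ends, the
trace is a combination of p and q with nonnegative coefficients whose sum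
exceeds 1, while p and q have the same sign because c x + d does not vanish in
between. *)
Lemma trace_contraction M (lo hi k : R) : lo < hi -> 0 < k ->
  (forall x, lo <= x <= hi -> k <= `|ec M * x + ed M| /\
     lo <= (ea M * x + eb M) / (ec M * x + ed M) <= hi) ->
  k <= `|tr2 M|.
Proof.
move=> lh k0 H.
have [jlo wlo] := H lo ltac:(lra); have [jhi whi] := H hi ltac:(lra).
have := SL2_detE M; rewrite /tr2 in H *.
move: (ea M) (eb M) (ec M) (ed M) H jlo wlo jhi whi => a b c d H jlo wlo jhi whi.
move=> dM.
have jlo0 : c * lo + d != 0 by rewrite -normr_gt0; lra.
have jhi0 : c * hi + d != 0 by rewrite -normr_gt0; lra.
set p := c * lo + d in jlo wlo jlo0; set q := c * hi + d in jhi whi jhi0.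
set wl := _ / p in wlo; set wh := _ / q in whi.
have el : p * wl = a * lo + b by rewrite /wl mulrC divfK.
have eh : q * wh = a * hi + b by rewrite /wh mulrC divfK.
have E : (a + d) * (hi - lo) = q * (wh - lo) + p * (hi - wl).
  have -> : q * (wh - lo) + p * (hi - wl) = q * wh - p * wl - q * lo + p * hi.
    by ring.
  by rewrite el eh /p /q; ring.
have D : (wh - wl) * (p * q) = hi - lo.
  have -> : (wh - wl) * (p * q) = p * (q * wh) - q * (p * wl) by ring.
  by rewrite el eh -[RHS]mul1r -dM /p /q; ring.
have pq : 0 < p * q.
  rewrite ltNge; apply/negP => pq.
  have qp0 : q - p != 0.
    apply/eqP => e; move: pq; have -> : q = p by lra.
    by rewrite leNgt -expr2 exprn_even_gt0 //= jlo0.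
  (* If p q <= 0 then this zero of c x + d lies in the segment. *)
  have [|j _] := H (lo - p * (hi - lo) / (q - p)); last first.
    move: j; suff -> : c * (lo - p * (hi - lo) / (q - p)) + d = 0.
      by rewrite normr0; lra.
    by move: qp0; rewrite /p /q => qp0; field.
  have : p / (q - p) <= 0 /\ -1 <= p / (q - p).
    have [qp|qp] := ltP 0 (q - p).
      have p0 : p <= 0 by nra.
      have q0 : 0 <= q by nra.
      by rewrite ler_pdivlMr// ler_pdivrMr//; lra.
    have {}qp : q - p < 0 by rewrite lt_neqAle qp0.
    have p0 : 0 <= p by nra.
    have q0 : q <= 0 by nra.
    by rewrite ler_ndivlMr// ler_ndivrMr//; lra.
  rewrite -mulrA [_ * (_ / _)]mulrCA; move: (p / (q - p)) => r [r1 r2].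
  by apply/andP; split; nra.
suff : k * (hi - lo) <= `|a + d| * (hi - lo) by rewrite ler_pM2r// subr_gt0.
rewrite -{2}[hi - lo]gtr0_norm ?subr_gt0// -normrM E.
have wwpos : 0 < wh - wl by nra.
have [p0|p0] := ltP 0 p.
  have q0 : 0 < q by nra.
  rewrite gtr0_norm// in jlo; rewrite gtr0_norm// in jhi.
  by apply: le_trans (ler_norm _); nra.
have {}p0 : p < 0 by rewrite lt_neqAle jlo0.
have q0 : q < 0 by nra.
rewrite ltr0_norm// in jlo; rewrite ltr0_norm// in jhi.
by rewrite -normrN; apply: le_trans (ler_norm _); nra.
Qed.

End SL2_entries.

(** * Ping-pong on the real line *)

(** The n-th generator has first column (dil n, rate n) and lower right entry
4. Both conditions say that the rates decrease fast; the second one takes into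
account how close to 1 the n-th dilation is. *)
Record schottky (R : realType) := Schottky {
  dil : nat -> R;
  rate : nat -> R;
  dil_gt1 : forall n, 1 < dil n;
  rate_gt0 : forall n, 0 < rate n;
  rate_sep : forall m n, (m < n)%N -> 2 * (dil m + 7) * rate n <= rate m;
  rate_dil : forall m n, (m < n)%N ->
    (dil m + 5) * rate n <= (dil n - 1) * rate m
}.

Section ping_pong.
Context {R : realType} (S : schottky R).
Local Notation a := (dil S).
Local Notation c := (rate S).

Fact gen_subproof n : a n * 4 - ((4 * a n - 1) / c n) * c n = 1.
Proof. by rewrite divfK ?gt_eqF ?rate_gt0//; ring. Qed.
Definition gen n : SL2 R := SL2_of (gen_subproof n).

Lemma genE n : [/\ ea (gen n) = a n, eb (gen n) = (4 * a n - 1) / c n,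
  ec (gen n) = c n & ed (gen n) = 4].
Proof. exact: SL2_ofE. Qed.

Definition letter (l : nat * bool) : SL2 R :=
  if l.2 then gen l.1 else (gen l.1)^-1%g.

Definition flip (l : nat * bool) := (l.1, ~~ l.2).

Lemma flipK : involutive flip.
Proof. by case=> n b; rewrite /flip /= negbK. Qed.

Lemma letter_flip l : letter (flip l) = (letter l)^-1%g.
Proof. by case: l => n []; rewrite /letter /= ?invgK. Qed.

Definition word (w : seq (nat * bool)) : SL2 R := (\prod_(l <- w) letter l)%g.

Lemma word_nil : word [::] = 1%g. Proof. exact: big_nil. Qed.
Lemma word_cons l w : word (l :: w) = (letter l * word w)%g.
Proof. exact: big_cons. Qed.
Lemma word_cat v w : word (v ++ w) = (word v * word w)%g.
Proof. exact: big_cat. Qed.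

Lemma word_rev_flip w : word (rev (map flip w)) = (word w)^-1%g.
Proof.
elim: w => [|l w IH]; first by rewrite /= word_nil invg1.
by rewrite /= rev_cons -cats1 word_cat word_cons word_nil mulg1 IH letter_flip
  -invgM word_cons.
Qed.

(** Vectors (p, q) stand for the points p / q of the real line. The cone of a
letter lies over an interval around the image of oo under it, of radius 1 / (2
c_n) around a_n / c_n for a generator and of radius 1 / c_n around - 4 / c_n
for its inverse. *)
Definition cone (l : nat * bool) (v : R * R) : bool :=
  if l.2 then `|c l.1 * v.1 - a l.1 * v.2| <= `|v.2| / 2
  else `|c l.1 * v.1 + 4 * v.2| <= `|v.2|.

Lemma cone_bounds l v : cone l v ->
  `|v.2| / 2 <= c l.1 * `|v.1| <= (a l.1 + 5) * `|v.2|.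
Proof.
have abs_c x p : c x * `|p| = `|c x * p|.
  by rewrite normrM gtr0_norm ?rate_gt0.
case: l v => n b [p q]; rewrite /cone /= abs_c.
have := mulr_ge0 (ltW (lt_trans ltr01 (dil_gt1 S n))) (normr_ge0 q).
have a1 := dil_gt1 S n; have qa := normr_ge0 q.
have h4 : 0 <= (a n - 1) * `|q| by rewrite mulr_ge0// subr_ge0 ltW.
case: b => aq.
  have := lerB_dist (a n * q) (c n * p); have := lerB_dist (c n * p) (a n * q).
  rewrite distrC [`|a n * q|]normrM [`|a n|]gtr0_norm ?(lt_trans ltr01)// => h1 h2 h3.
  by apply/andP; split; lra.
have := lerB_normD (4 * q) (c n * p); have := lerB_normD (c n * p) (4 * q).
rewrite [4 * q + _]addrC [`|4 * q|]normrM normr_nat => h1 h2 h3; apply/andP; split; lra.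
Qed.

(** The points that the letter contracts: 0, which lies in no interval, and the
points of the intervals of all letters but its inverse. *)
Definition admissible l v := v.1 = 0 \/ exists2 l', l' != flip l & cone l' v.

(** The second coordinate of the image is c_n p + 4 q for a generator and a_n q
- c_n p for its inverse. If p / q lies in the interval of a letter of smaller
index, then c_n p is negligible before q and before (a_n - 1) q; for a larger
index it dominates; for the same index the interval itself says how close c_n p
is to a_n q or to - 4 q. *)
Lemma ping_pong l v : admissible l v ->
  (if l.2 then 3 else 1) * `|v.2| <= `|(vact (letter l) v).2|.
Proof.
have abs_nrm x : c x = `|c x| by rewrite gtr0_norm ?rate_gt0.
case: l v => n b [p q]; have a1 := dil_gt1 S n; have c0 := rate_gt0 S n.
have aq : 0 <= (a n - 1) * `|q| by rewrite mulr_ge0// subr_ge0 ltW.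
have q0 := normr_ge0 q; have p0 := normr_ge0 p.
have aN x : 0 < x -> `|x * q| = x * `|q| by move=> ?; rewrite normrM gtr0_norm.
case=> [/= ->|[[m b'] ne cn]].
  rewrite /letter /vact; case: b => /=.
    by have [_ _ -> ->] := genE n; rewrite mulr0 add0r aN//; lra.
  have [_ _ -> ->] := SL2_invE (gen n); have [-> _ -> _] := genE n.
  by rewrite mulr0 add0r aN ?(lt_trans ltr01)//; lra.
have := cone_bounds cn; rewrite /= => /andP[lo hi].
have am1 := dil_gt1 S m; have cm0 := rate_gt0 S m.
have cp x : c x * `|p| = `|c x * p| by rewrite normrM -abs_nrm.
have big : (n < m)%N -> (a n + 7) * `|q| <= `|c n * p|.
  by move=> /(rate_sep S) h; rewrite -cp; nra.
have small : (m < n)%N -> `|c n * p| <= `|q| /\ `|c n * p| <= (a n - 1) * `|q|.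
  move=> lt; have h1 := rate_sep S lt; have h2 := rate_dil S lt; rewrite -cp.
  have h3 : (a m + 5) * (c n * `|p|) <= (a m + 5) * ((a n - 1) * `|q|).
    have -> : (a m + 5) * (c n * `|p|) = ((a m + 5) * c n) * `|p| by ring.
    apply: (le_trans (ler_wpM2r p0 h2)).
    have -> : (a n - 1) * c m * `|p| = (a n - 1) * (c m * `|p|) by ring.
    by rewrite [leRHS]mulrCA ler_pM2l// subr_gt0.
  have h4 : (a m + 5) * (c n * `|p|) <= (a m + 5) * `|q|.
    by apply: le_trans hi; nra.
  by move: h3 h4; rewrite !ler_pM2l//; lra.
rewrite /letter /vact; case: b ne => /= ne.
  have [_ _ -> ->] := genE n.
  have := lerB_normD (4 * q) (c n * p); have := lerB_normD (c n * p) (4 * q).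
  rewrite [4 * q + _]addrC (aN 4)//.
  have [lt|lt|e] := ltngtP m n.
  - by have [h _] := small lt; lra.
  - by have := big lt; lra.
  case: b' cn ne; rewrite /cone /flip /= e ?eqxx// => h _ _ _.
  have -> : c n * p + 4 * q = (a n + 4) * q + (c n * p - a n * q) by ring.
  by have := lerB_normD ((a n + 4) * q) (c n * p - a n * q); rewrite aN; lra.
have [_ _ -> ->] := SL2_invE (gen n); have [-> _ -> _] := genE n.
rewrite mulNr addrC.
have := lerB_dist (a n * q) (c n * p); have := lerB_dist (c n * p) (a n * q).
rewrite distrC aN ?(lt_trans ltr01)//.
have [lt|lt|e] := ltngtP m n.
- by have [_ h] := small lt; lra.
- by have := big lt; lra.
case: b' cn ne; rewrite /cone /flip /= e ?eqxx// => h _ _ _.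
have -> : a n * q - c n * p = (a n + 4) * q - (c n * p + 4 * q) by ring.
by have := lerB_dist ((a n + 4) * q) (c n * p + 4 * q); rewrite aN; lra.
Qed.

(** With q' the second coordinate of the image (p', q'), the quantity that the
cone bounds is c_n p' - a_n q' = - q or c_n p' + 4 q' = q. *)
Lemma cone_ping_pong l v : admissible l v -> cone l (vact (letter l) v).
Proof.
move=> /ping_pong; case: l v => n b [p q]; have c0 := rate_gt0 S n.
have c00 : c n != 0 by rewrite gt_eqF.
rewrite /letter /vact /cone; case: b => /=.
  have [-> -> -> ->] := genE n.
  set q' := c n * p + _ => h.
  suff -> : c n * (a n * p + (4 * a n - 1) / c n * q) - a n * q' = - q.
    by rewrite normrN; have := normr_ge0 q'; lra.
  by rewrite /q'; field.
have [-> -> -> ->] := SL2_invE (gen n); have [-> -> -> ->] := genE n.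
set q' := - c n * p + _ => h.
suff -> : c n * (4 * p + - ((4 * a n - 1) / c n) * q) + 4 * q' = q.
  by move: h; rewrite mul1r.
by rewrite /q'; field.
Qed.

Definition reduced (w : seq (nat * bool)) : bool :=
  sorted (fun l l' => l' != flip l) w.

Lemma word_reduced w :
  exists2 w', reduced w' &
    [/\ {subset w' <= w}, (size w' <= size w)%N & word w' = word w].
Proof.
elim: w => [|l w [w' rw' [sw' zw' ew']]]; first by exists [::].
case: w' rw' sw' zw' ew' => [_ _ _ ew|l' w' rw' sw' zw' ew'].
  exists [:: l] => //; split=> // [x|]; last by rewrite !word_cons -ew.
  by rewrite !inE => ->.
have [e|ne] := eqVneq l' (flip l).
  exists w'; first exact: path_sorted rw'.
  split=> [x xw'||]; first by rewrite inE sw' ?orbT// inE xw' orbT.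
    by apply: leq_trans (leqnSn _); apply: leq_trans zw'; exact: leqnSn.
  by rewrite word_cons -ew' word_cons e letter_flip mulVKg.
exists [:: l, l' & w']; first by rewrite /reduced /= ne.
split=> // [x|]; last by rewrite !word_cons -ew' word_cons.
by rewrite inE => /orP[/eqP ->|/sw' xw]; rewrite inE ?eqxx ?xw ?orbT.
Qed.

(** In a reduced word each letter acts on a point of the interval of the next
one, which is not its inverse. *)
Lemma word_ping_pong l w v : reduced (l :: w) ->
  admissible (last l w) v ->
  (if has snd (l :: w) then 3 else 1) * `|v.2| <= `|(vact (word (l :: w)) v).2|
  /\ cone l (vact (word (l :: w)) v).
Proof.
elim: w l => [|l' w IH] l rw adm.
  rewrite word_cons word_nil mulg1 /= orbF; split; first exact: ping_pong.
  exact: cone_ping_pong.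
have /andP[ne rw'] : (l' != flip l) && reduced (l' :: w) by [].
have [big cn] := IH l' rw' adm.
rewrite word_cons vactM.
have adm' : admissible l (vact (word (l' :: w)) v) by right; exists l'.
split; last exact: cone_ping_pong.
have := ping_pong adm'; move: big.
have -> : has snd [:: l, l' & w] = l.2 || has snd (l' :: w) by [].
have := normr_ge0 v.2; by case: l.2; case: (has snd (l' :: w)) => /=; lra.
Qed.

Lemma word_ed_ge1 w : 1 <= `|ed (word w)|.
Proof.
have [[|l w'] rw [_ _ <-]] := word_reduced w.
  by rewrite word_nil; have [_ _ _ ->] := @SL2_1E R; rewrite normr1.
have [] := word_ping_pong (v := (0, 1)) rw (or_introl erefl).
rewrite /vact /= mulr0 add0r mulr1 normr1 mulr1 => h _.
by apply: (le_trans _ h); case: ifP => _; lra.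
Qed.

(** A reduced word maps 0 into the interval of its first letter, and 0 belongs
to no interval. *)
Lemma reduced_neq1 l w : reduced (l :: w) ->
  word (l :: w) <> 1%g /\ word (l :: w) <> SL2_opp 1%g.
Proof.
move=> rw; have [_] := word_ping_pong (v := (0, 1)) rw (or_introl erefl).
move=> /cone_bounds; rewrite /vact /= !mulr0 !add0r !mulr1.
move=> h; have dge1 := word_ed_ge1 (l :: w).
split=> e; move: h dge1; rewrite e.
  by have [_ -> _ ->] := @SL2_1E R; rewrite normr0 mulr0 normr1; lra.
have [_ -> _ ->] := SL2_oppE (1%g : SL2 R); have [_ -> _ ->] := @SL2_1E R.
by rewrite oppr0 normr0 mulr0 normrN normr1; lra.
Qed.

Lemma word_gen_independent w n : (forall l, l \in w -> (l.1 < n)%N) ->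
  word w <> gen n /\ word w <> SL2_opp (gen n).
Proof.
have [w' rw' [sw' _ <-]] := word_reduced w => lt.
have rw : reduced ((n, false) :: w').
  case: w' rw' sw' => // l w' rw' sw'; rewrite /reduced /= [path _ _ _]rw' andbT.
  have /lt : l \in w by rewrite sw'// inE eqxx.
  by apply: contraTneq => ->; rewrite ltnn.
have [n1 n2] := reduced_neq1 rw.
split=> e; [apply: n1|apply: n2]; rewrite word_cons e /letter /=.
  by rewrite mulVg.
by rewrite SL2_oppMr mulVg.
Qed.

(** A cyclically reduced word maps the interval of its first letter into
itself, and one generator among its letters suffices to expand by 3. *)
Lemma trace_cyclically_reduced l w :
  cycle (fun l l' => l' != flip l) (l :: w) -> has snd (l :: w) ->
  3 <= `|tr2 (word (l :: w))|.
Proof.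
rewrite [cycle _ _]/= rcons_path => /andP[rw ne] pos.
pose ctr := if l.2 then a l.1 / c l.1 else - 4 / c l.1.
pose rad := (if l.2 then 2^-1 else 1) / c l.1.
have c0 := rate_gt0 S l.1.
have coneE x : cone l (x, 1) = (ctr - rad <= x <= ctr + rad).
  have xE : x = c l.1 * x / c l.1 by rewrite mulrC mulKf// gt_eqF.
  rewrite [in RHS]xE /cone /ctr /rad /=; case: l.2.
    by rewrite -mulrBl -mulrDl !ler_pM2r ?invr_gt0// mulr1 normr1 ler_distl mul1r.
  rewrite -mulrBl -mulrDl !ler_pM2r ?invr_gt0// mulr1 normr1 ler_norml.
  by apply/andP/andP => -[]; split; lra.
have r0 : 0 < rad by rewrite /rad divr_gt0//; case: l.2 => //; lra.
apply: (@trace_contraction _ _ (ctr - rad) (ctr + rad)) => // [|x]; first by lra.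
rewrite -coneE => cx.
have [|big cn] := @word_ping_pong l w (x, 1) rw.
  by right; exists l.
move: big cn; rewrite pos /vact /= normr1 !mulr1.
move: (word _) => M; set q := _ + ed M; set p := _ + eb M => hq cn.
split=> //; rewrite -coneE; move: cn; rewrite /cone /=.
have q0 : 0 < `|q| by lra.
have q00 : q != 0 by rewrite -normr_gt0.
case: l.2; rewrite normr1.
  have -> : c l.1 * p - a l.1 * q = (c l.1 * (p / q) - a l.1 * 1) * q by field.
  by rewrite normrM mulrC ler_pM2l// mul1r.
have -> : c l.1 * p + 4 * q = (c l.1 * (p / q) + 4 * 1) * q by field.
by rewrite normrM -[leRHS]mul1r ler_pM2r.
Qed.

(** The trace only depends on the cyclically reduced conjugate. A word without
positive letter is replaced by its inverse, which has the same trace. *)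
Lemma trace_word w : word w = 1%g \/ 3 <= `|tr2 (word w)|.
Proof.
have [n] := ubnP (size w); elim: n w => // n IH w /ltnSE sw.
have [[|l t] rw [_ zw <-]] := word_reduced w; first by left; exact: word_nil.
have [cyc|] := boolP (cycle (fun l l' => l' != flip l) (l :: t)).
  right; have [|neg] := boolP (has snd (l :: t)).
    exact: trace_cyclically_reduced.
  rewrite -tr2V -word_rev_flip.
  have : cycle (fun l l' => l' != flip l) (rev (map flip (l :: t))).
    rewrite rev_cycle cycle_map.
    by apply: sub_cycle cyc => x y; rewrite /relpre /= flipK eq_sym.
  have : has snd (rev (map flip (l :: t))).
    by rewrite has_rev has_map /= (negbTE (proj1 (norP neg))).
  case: (rev _) => // l' t'; move=> ? ?; exact: trace_cyclically_reduced.
rewrite [cycle _ _]/= rcons_path [path _ _ _]rw /= negbK.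
case/lastP: t rw zw => [|t l'] rw zw /eqP /= e.
  by move: e; rewrite /flip; case: (l) => ? [].
rewrite last_rcons in e.
have cj : word (l :: rcons t l') = (letter l * word t * (letter l)^-1)%g.
  by rewrite -cats1 word_cons word_cat word_cons word_nil mulg1 mulgA
    -letter_flip e flipK.
have [|e1|h] := IH t.
- by apply: leq_trans sw; apply: leq_trans zw; rewrite /= size_rcons.
- by left; rewrite cj e1 mulg1 mulgV.
- by right; rewrite cj tr2C mulKg.
Qed.

End ping_pong.

(** * Displacement in the hyperbolic plane *)
Section separation.
Context {R : realType}.
Implicit Types (z w : hplane R) (M : SL2 R).

Definition hx z : R := (hplane_coord z).1.
Definition hy z : R := (hplane_coord z).2.

Lemma hy_gt0 z : 0 < hy z. Proof. exact: (valP z). Qed.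

Lemma hplaneP z w : hx z = hx w -> hy z = hy w -> z = w.
Proof.
case: z w => -[x y] p [[x' y'] q]; rewrite /hx /hy /= => ex ey.
by apply: val_inj; rewrite /= ex ey.
Qed.

(** The squared modulus of the cocycle c z + d. *)
Definition cnorm M z : R := (ec M * hx z + ed M) ^+ 2 + (ec M * hy z) ^+ 2.

Lemma cnorm_gt0 M z : 0 < cnorm M z.
Proof.
have [c0|c0] := eqVneq (ec M) 0.
  have d0 : ed M != 0.
    apply/eqP => d0; have := SL2_detE M; rewrite c0 d0 !mulr0 subr0.
    by move/eqP; rewrite eq_sym oner_eq0.
  by rewrite /cnorm c0 !mul0r add0r expr0n addr0 exprn_even_gt0.
rewrite /cnorm ltr_wpDl ?sqr_ge0// exprn_even_gt0//= mulf_neq0//.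
by rewrite gt_eqF// hy_gt0.
Qed.

Lemma hact_coord M z :
  hx (hact M z) = ((ea M * hx z + eb M) * (ec M * hx z + ed M) +
    ea M * ec M * hy z ^+ 2) / cnorm M z /\
  hy (hact M z) = hy z / cnorm M z.
Proof.
have := cnorm_gt0 M z; have := SL2_detE M.
rewrite /cnorm; case: z => -[x y] y0; rewrite /hx /hy /hplane_coord /= in y0 *.
rewrite /mobius /cocycle /SL2_val.
move: (val M 0 0) (val M 0 1) (val M 1 0) (val M 1 1) => a b c d dM j0.
have j1 := lt0r_neq0 j0.
simpc; rewrite /=; split; first by field.
by rewrite -{1}[y in RHS]mul1r -dM; field.
Qed.

Lemma hactN M z : hact (SL2_opp M) z = hact M z.
Proof.
have [h1 h2 h3 h4] := SL2_oppE M.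
have [e1 e2] := hact_coord M z; have [e3 e4] := hact_coord (SL2_opp M) z.
have ce : cnorm (SL2_opp M) z = cnorm M z by rewrite /cnorm h3 h4; ring.
by apply: hplaneP; rewrite ?e1 ?e2 ?e3 ?e4 ce ?h1 ?h2 ?h3 ?h4//; congr (_ / _); ring.
Qed.

(** This is 2 (cosh d - 1) for the hyperbolic distance d. Being rational in the
coordinates, it is handier than d, and it is just as good to measure nearness
(see [sep_weak_triangle]). *)
Definition sep z w : R :=
  ((hx z - hx w) ^+ 2 + (hy z - hy w) ^+ 2) / (hy z * hy w).

Lemma hdist_sep z w : hdist z w = arcosh (1 + sep z w / 2).
Proof.
have := hy_gt0 z; have := hy_gt0 w; rewrite /hdist /sep /hx /hy.
case: (hplane_coord z) (hplane_coord w) => x y [x' y'] /= y0 y0'.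
by congr (arcosh (1 + _)); field; rewrite !gt_eqF.
Qed.

Lemma sepzz z : sep z z = 0.
Proof. by rewrite /sep !subrr expr0n /= addr0 mul0r. Qed.

Lemma sepC z w : sep z w = sep w z.
Proof. by rewrite /sep (mulrC (hy z)); congr (_ / _); ring. Qed.

Lemma sep_hact M z w : sep (hact M z) (hact M w) = sep z w.
Proof.
have [e1 e2] := hact_coord M z; have [e3 e4] := hact_coord M w.
rewrite /sep e1 e2 e3 e4; have := hy_gt0 z; have := hy_gt0 w.
have := cnorm_gt0 M z; have := cnorm_gt0 M w; have := SL2_detE M.
rewrite /cnorm; move: (ea M) (eb M) (ec M) (ed M) => a b c d dM.
move: (hx z) (hy z) (hx w) (hy w) => x y x' y' j j' y0 y0'.
set X := _ + a * c * y ^+ 2; set X' := _ + a * c * y' ^+ 2.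
set J := _ + (c * y) ^+ 2 in j' *; set J' := _ + (c * y') ^+ 2 in j *.
have key : (X * J' - X' * J) ^+ 2 + (y * J' - y' * J) ^+ 2 =
    J * J' * ((x - x') ^+ 2 + (y - y') ^+ 2).
  have : (X * J' - X' * J) ^+ 2 + ((a * d - b * c) * (y * J' - y' * J)) ^+ 2 =
      (a * d - b * c) ^+ 2 * (J * J' * ((x - x') ^+ 2 + (y - y') ^+ 2)).
    by rewrite /X /X' /J /J'; ring.
  by rewrite dM expr1n !mul1r.
have [J0 J'0] := (lt0r_neq0 j', lt0r_neq0 j).
have [z0 z'0] := (lt0r_neq0 y0, lt0r_neq0 y0').
have -> : ((X / J - X' / J') ^+ 2 + (y / J - y' / J') ^+ 2) /
    (y / J * (y' / J')) =
    ((X * J' - X' * J) ^+ 2 + (y * J' - y' * J) ^+ 2) / (J * J' * (y * y')).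
  by field; rewrite J0 J'0 z0 z'0.
by rewrite key -mulf_div divff ?mul1r// mulf_neq0.
Qed.

(** The difference of both sides is a square. With P = c x + d, E = a - c x, B
= y (P - E) and A the polynomial below, the differences of the coordinates of z
and M z are, up to sign, the real and imaginary parts of (A + i B) (c z + d),
divided by |c z + d|^2. *)
Lemma sep_trace M z : tr2 M ^+ 2 - 4 <= sep z (hact M z).
Proof.
have [e1 e2] := hact_coord M z; have := hy_gt0 z; have := cnorm_gt0 M z.
rewrite /sep e1 e2 /cnorm /tr2; have := SL2_detE M.
move: (ea M) (eb M) (ec M) (ed M) => a b c d dM.
move: (hx z) (hy z) => x y.
set J := _ + _ => j y0; have j1 := lt0r_neq0 j; have y1 := lt0r_neq0 y0.
pose P := c * x + d; pose E := a - c * x.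
pose A := b + (a - d) * x - c * x ^+ 2 + c * y ^+ 2; pose B := y * (P - E).
suff -> : ((x - ((a * x + b) * (c * x + d) + a * c * y ^+ 2) / J) ^+ 2 +
    (y - y / J) ^+ 2) / (y * (y / J)) =
    (a + d) ^+ 2 - 4 + ((A - 2 * c * y ^+ 2) / y) ^+ 2.
  by rewrite lerDl sqr_ge0.
have h1 : x - ((a * x + b) * (c * x + d) + a * c * y ^+ 2) / J =
    - (P * A - c * y * B) / J.
  by apply: (mulIf j1); rewrite mulrBl !divfK// /J /A /B /E /P; ring.
have h2 : y - y / J = (P * B + c * y * A) / J.
  apply: (mulIf j1); rewrite mulrBl !divfK//.
  have -> : y * J - y = y * J - y * (a * d - b * c) by rewrite dM mulr1.
  by rewrite /J /A /B /E /P; ring.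
have JE : J = P ^+ 2 + (c * y) ^+ 2 by [].
have -> : (a + d) ^+ 2 - 4 + ((A - 2 * c * y ^+ 2) / y) ^+ 2 =
    (A ^+ 2 + B ^+ 2) / y ^+ 2.
  have -> : (a + d) ^+ 2 - 4 = (a + d) ^+ 2 - 4 * (a * d - b * c).
    by rewrite dM mulr1.
  by rewrite /A /B /P /E; field.
have JAB : (P * A - c * y * B) ^+ 2 + (P * B + c * y * A) ^+ 2 =
    J * (A ^+ 2 + B ^+ 2) by rewrite JE; ring.
have -> : (A ^+ 2 + B ^+ 2) / y ^+ 2 = J * (A ^+ 2 + B ^+ 2) / (J * y ^+ 2).
  by rewrite -mulf_div divff// mul1r.
by rewrite -JAB h1 h2; field; rewrite j1 y1.
Qed.

(** If z and w are at separation at most 1 then the ratio of their heights is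
at most 3, so that the denominators y_z y_w, y_w y_t and y_z y_t are
comparable. *)
Lemma sep_weak_triangle z w t (r s : R) : sep z w <= r -> sep w t <= s ->
  r <= 1 -> s <= 1 -> sep z t <= 6 * (r + s).
Proof.
have y0 := hy_gt0 z; have y1 := hy_gt0 w; have y2 := hy_gt0 t.
rewrite /sep !ler_pdivrMr ?mulr_gt0//.
move: (hx z) (hx w) (hx t) (hy z) (hy w) (hy t) y0 y1 y2 => a b c x y u.
move=> x0 y0 u0 h1 h2 r1 s1.
have r0 : 0 <= r * (x * y) by apply: le_trans h1; rewrite addr_ge0 ?sqr_ge0.
have s0 : 0 <= s * (y * u) by apply: le_trans h2; rewrite addr_ge0 ?sqr_ge0.
rewrite !pmulr_lge0 ?mulr_gt0// in r0 s0.
have ratio (p q k : R) : 0 < p -> 0 < q -> 0 <= k -> k <= 1 ->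
    (p - q) ^+ 2 <= k * (p * q) -> p <= 3 * q.
  move=> p0 q0 k0 k1 h; rewrite leNgt; apply/negP => pq.
  have : k * (p * q) <= p * q by nra.
  nra.
have yu : y <= 3 * u by apply: (ratio _ _ s) => //; have := sqr_ge0 (b - c); lra.
have yx : y <= 3 * x by apply: (ratio _ _ r) => //; have := sqr_ge0 (a - b); lra.
have h3 : (a - c) ^+ 2 + (x - u) ^+ 2 <= 2 * (r * (x * y) + s * (y * u)).
  have g (p q : R) : (p + q) ^+ 2 <= 2 * (p ^+ 2 + q ^+ 2).
    by have := sqr_ge0 (p - q); nra.
  have := g (a - b) (b - c); have := g (x - y) (y - u).
  have -> : a - b + (b - c) = a - c by ring.
  have -> : x - y + (y - u) = x - u by ring.
  lra.
apply: (le_trans h3).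
have : r * (x * y) <= r * (x * (3 * u)) by rewrite ler_wpM2l// ler_pM2l.
have : s * (y * u) <= s * (3 * x * u) by rewrite ler_wpM2l// ler_pM2r.
lra.
Qed.

Lemma le_arcosh (x y : R) : 1 <= x -> x <= y -> arcosh x <= arcosh y.
Proof.
move=> x1 xy; rewrite /arcosh ler_ln ?posrE.
- by rewrite lerD// ler_sqrt; nra.
- by rewrite ltr_wpDr ?sqrtr_ge0//; lra.
- by rewrite ltr_wpDr ?sqrtr_ge0//; lra.
Qed.

Lemma arcosh_gt0 (x : R) : 1 < x -> 0 < arcosh x.
Proof. by move=> x1; rewrite /arcosh ln_gt0// ltr_wpDr// sqrtr_ge0. Qed.

Lemma ln_le_arcosh (r x : R) : 1 <= r -> (r + r^-1) / 2 <= x ->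
  ln r <= arcosh x.
Proof.
move=> r1 rx; have r0 : 0 < r by lra.
have rr : r * r^-1 = 1 by rewrite divff// gt_eqF.
have ri0 : 0 < r^-1 by rewrite invr_gt0.
have rV : r^-1 <= r by nra.
have x1 : 1 <= x.
  by apply: le_trans rx; have := sqr_ge0 (r - 1); nra.
rewrite /arcosh ler_ln ?posrE ?ltr_wpDr ?sqrtr_ge0//; last by lra.
have : (r - r^-1) / 2 <= Num.sqrt (x ^+ 2 - 1).
  rewrite -[leLHS]ger0_norm; last by lra.
  rewrite -sqrtr_sqr ler_sqrt; nra.
lra.
Qed.

Lemma hdist_ge_ln z w : hy z <= hy w -> ln (hy w / hy z) <= hdist z w.
Proof.
move=> zw; rewrite hdist_sep; have y0 := hy_gt0 z; have y1 := hy_gt0 w.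
apply: ln_le_arcosh; first by rewrite ler_pdivlMr// mul1r.
rewrite /sep invf_div.
have := sqr_ge0 (hx z - hx w).
move: (hx z - hx w) (hy z) (hy w) y0 y1 {zw} => x y u y0 u0 h.
rewrite -subr_ge0.
have -> : 1 + (x ^+ 2 + (y - u) ^+ 2) / (y * u) / 2 - (u / y + y / u) / 2 =
  x ^+ 2 / (2 * (y * u)) by field; rewrite !gt_eqF.
by rewrite divr_ge0// !mulr_ge0// ltW.
Qed.

End separation.

(** * Uniform continuity of maps into the surface *)
Section quotient_uniformity.
Local Open Scope quotient_scope.
Context {R : realType} (G : surface_group R).
Implicit Types (z w : hplane R) (M : SL2 R) (p q : surface G).

Lemma hx_continuous : continuous (@hx R).
Proof.
move=> z; apply: (@continuous_comp _ _ _ (@hplane_coord R) fst).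
  exact: (@initial_continuous _ _ (@hplane_coord R)).
exact: cvg_fst.
Qed.

Lemma hy_continuous : continuous (@hy R).
Proof.
move=> z; apply: (@continuous_comp _ _ _ (@hplane_coord R) snd).
  exact: (@initial_continuous _ _ (@hplane_coord R)).
exact: cvg_snd.
Qed.

Lemma sep_formula_continuous (T : topologicalType) (f g : T -> R) (a b : R) :
  continuous f -> continuous g -> (forall t, b * g t != 0) ->
  continuous (fun t => ((a - f t) ^+ 2 + (b - g t) ^+ 2) / (b * g t)).
Proof.
move=> cf cg g0 t.
have -> : (fun t => ((a - f t) ^+ 2 + (b - g t) ^+ 2) / (b * g t)) =
    (fun t => ((a - f t) * (a - f t) + (b - g t) * (b - g t)) * (b * g t)^-1).
  by apply/funext => s; rewrite !expr2.
have cx : (a - f s) @[s --> t] --> a - f t.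
  by apply: cvgB; [exact: cvg_cst|exact: cf].
have cy : (b - g s) @[s --> t] --> b - g t.
  by apply: cvgB; [exact: cvg_cst|exact: cg].
apply: cvgM; first by apply: cvgD; apply: cvgM.
by apply: cvgV => //; apply: cvgM; [exact: cvg_cst|exact: cg].
Qed.

Lemma sep_continuous z : continuous (sep z).
Proof.
apply: (sep_formula_continuous hx_continuous hy_continuous) => w.
by rewrite mulf_neq0// gt_eqF// hy_gt0.
Qed.

Definition hproj z : surface G := \pi_(surface G) z.

Lemma hproj_continuous : continuous hproj.
Proof. exact: pi_continuous. Qed.

Lemma hproj_repr p : exists z, hproj z = p.
Proof. by exists (repr p); rewrite /hproj reprK. Qed.

Lemma deckV M : deck G M -> deck G M^-1%g.
Proof. by move=> GM; rewrite -[M^-1%g]mulg1; exact: (deckVM GM (deck1 G)). Qed.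

Lemma hproj_eqP z w : hproj z = hproj w <-> exists2 M, deck G M & w = hact M z.
Proof.
split=> [/(@eqmodP _ (surface_rel G))/asboolP//|h].
by apply/(@eqmodP _ (surface_rel G))/asboolP.
Qed.

Lemma hproj_hact M z : deck G M -> hproj (hact M z) = hproj z.
Proof. by move=> GM; apply/esym/hproj_eqP; exists M. Qed.

Definition near_lifts (r : R) p q :=
  exists z w, [/\ hproj z = p, hproj w = q & sep z w < r].

Lemma near_lifts_from r z q : near_lifts r (hproj z) q ->
  exists2 w, hproj w = q & sep z w < r.
Proof.
move=> [z' [w' [/hproj_eqP[M GM ->] <- h]]].
by exists (hact M w'); rewrite ?hproj_hact// sep_hact.
Qed.

Lemma near_lifts_nbhs r z : 0 < r ->
  \forall q \near hproj z, exists2 w, hproj w = q & sep z w < r.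
Proof.
move=> r0; apply: open_nbhs_nbhs; split; last first.
  by exists z => //; rewrite sepzz.
rewrite /open /= /quotient_open.
have -> : \pi_(surface G) @^-1` [set q | exists2 w, hproj w = q & sep z w < r] =
    \bigcup_(M in deck G) (sep (hact M z) @^-1` [set x | x < r]).
  apply/seteqP; split=> [w [w' /hproj_eqP[M GM ->] h]|w [M GM h]].
    by exists M => //=; rewrite sep_hact.
  exists (hact M^-1%g w); first by rewrite hproj_hact//; exact: deckV.
  by rewrite -(sep_hact M) -hactM mulgV hact1.
apply: bigcup_open => M _; apply: open_comp => [w _|]; first exact: sep_continuous.
exact: open_lt.
Qed.

(** The sets of points with a lift in a given ball are open and cover the
surface; this is the Lebesgue number lemma for that covering. *)
Lemma compact_near_lifts (X : pseudoMetricType R) (K : set X)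
    (F : X -> surface G) (r : R) : 0 < r -> compact K ->
  {within K, continuous F} -> exists2 d : R, 0 < d &
  forall x y, K x -> K y -> ball x d y -> near_lifts r (F x) (F y).
Proof.
move=> r0 /compact_near_coveringP/near_covering_withinP cK.
move=> /subspace_continuousP cF.
(* Below r / 12 and at most 1, as 12 is the constant in the weak triangle
   inequality for two equal bounds. *)
pose s := Num.min 1 (r / 13).
have s0 : 0 < s by rewrite lt_min ltr01 divr_gt0.
have s1 : s <= 1 by rewrite ge_min lexx.
have sr : 12 * s < r.
  by apply: (@le_lt_trans _ _ (12 * (r / 13))); [rewrite ler_pM2l// ge_min lexx orbT|lra].
have near_dist : \forall d \near (0 : R)^'+, K `<=` [set x | forall y, K y ->
    ball x d y -> near_lifts r (F x) (F y)].
  apply: cK => x Kx; have [z zx] := hproj_repr (F x).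
  have := near_lifts_nbhs z s0; rewrite zx => /(cF x Kx).
  rewrite /fmap /within /=.
  move=> /nbhs_ballP[e e0 he].
  exists (ball x (e / 2), [set d : R | d < e / 2]).
    split; first by apply: nbhsx_ballx; rewrite divr_gt0.
    by apply: nbhs_right_lt; rewrite divr_gt0.
  move=> [x' d] [/= xx' de] Kx' y Ky xy.
  have [|w wx' hw] := he x' _ Kx'.
    by apply: le_ball xx'; rewrite ler_pdivrMr// ler_pMr// ler1n.
  have [|w' wy hw'] := he y _ Ky.
    rewrite [e]splitr; apply: ball_triangle xx' _.
    by apply: le_ball xy; exact: ltW.
  exists w, w'; split=> //; rewrite sepC in hw.
  apply: le_lt_trans sr.
  by have := sep_weak_triangle (ltW hw) (ltW hw') s1 s1; lra.
have [d [d0 hd]] : exists d : R, 0 < d /\ K `<=` [set x | forall y, K y ->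
    ball x d y -> near_lifts r (F x) (F y)].
  near (0 : R)^'+ => d; exists d; split; first by near: d; exact: nbhs_right_gt.
  by near: d.
by exists d => // x y Kx; apply: hd.
Unshelve. all: by end_near. Qed.

End quotient_uniformity.

(** * Lifting paths and homotopies *)

(** Two different lifts of a point are at separation more than 144 e. The weak
triangle inequality, used twice, turns four steps of separation e into two of
12 e and these into one of 144 e. So a point has at most one lift near a given
point, and paths are lifted step by step along a subdivision of the unit
interval. *)
Section path_lifting.
Context {R : realType} (G : surface_group R) (e : R).
Hypotheses (e0 : 0 < e) (e1 : 12 * e <= 1).
Hypothesis deck_far : forall z M, deck G M -> M <> 1%g -> M <> SL2_opp 1%g ->
  144 * e < sep z (hact M z).
Implicit Types (z w : hplane R) (M : SL2 R) (p q : surface G).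
Implicit Types (c : R -> surface G) (f : R -> hplane R).
Local Notation hproj := (@hproj R G).

Lemma hproj_inj_near z w : hproj z = hproj w -> sep z w <= 144 * e -> z = w.
Proof.
move=> /hproj_eqP[M GM ->] h; have [->|n1] := pselect (M = 1%g).
  by rewrite hact1.
have [->|nN1] := pselect (M = SL2_opp 1%g); first by rewrite hactN hact1.
by move: h; rewrite leNgt deck_far.
Qed.

Lemma near_chain_eq z0 z1 z2 z3 z4 : hproj z0 = hproj z4 ->
  sep z0 z1 < e -> sep z1 z2 < e -> sep z2 z3 < e -> sep z3 z4 < e -> z0 = z4.
Proof.
have le1 : e <= 1 by move: e0 e1; lra.
move=> eq h1 h2 h3 h4; apply: hproj_inj_near => //.
have h12 := sep_weak_triangle (ltW h1) (ltW h2) le1 le1.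
have h34 := sep_weak_triangle (ltW h3) (ltW h4) le1 le1.
have := sep_weak_triangle h12 h34.
have -> : 6 * (e + e) = 12 * e by ring.
by move=> /(_ e1 e1) h; apply: (le_trans h); lra.
Qed.

Definition uniform_path f := forall r : R, 0 < r -> exists2 d : R, 0 < d &
  forall s t, 0 <= s <= 1 -> 0 <= t <= 1 -> `|s - t| < d -> sep (f s) (f t) < r.

Definition uniform_surface_path c := forall r : R, 0 < r ->
  exists2 d : R, 0 < d &
  forall s t, 0 <= s <= 1 -> 0 <= t <= 1 -> `|s - t| < d ->
  near_lifts r (c s) (c t).

Definition lift_of c f :=
  (forall t, 0 <= t <= 1 -> hproj (f t) = c t) /\ uniform_path f.

Lemma unit_interval_ind (P : R -> Prop) (d : R) : 0 < d -> P 0 ->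
  (forall s t, 0 <= s -> s <= t -> t <= 1 -> t - s < d -> P s -> P t) ->
  forall t, 0 <= t <= 1 -> P t.
Proof.
move=> d0 P0 step t /andP[t0 t1].
have h (k : nat) : forall t, 0 <= t <= 1 -> t <= k%:R * (d / 2) -> P t.
  elim: k => [|k IH] {t t0 t1} t /andP[t0 t1].
    by rewrite mul0r => t0'; have -> : t = 0 by apply/le_anti; rewrite t0' t0.
  rewrite -natr1 => tk; have [td|td] := leP t (d / 2).
    by apply: (step 0) => //; lra.
  by apply: (step (t - d / 2)); try lra; apply: IH; lra.
apply: (h (Num.truncn (t / (d / 2))).+1); first by rewrite t0.
rewrite -ler_pdivrMr; last by lra.
by have /truncn_itv/andP[_ /ltW] : 0 <= t / (d / 2) by rewrite divr_ge0//; lra.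
Qed.

(** Lifts of two paths that are close to each other at every time stay close if
they start so: along a short time step the lift of c' t near f t is f' t, since
both are joined by a chain of four short steps. *)
Lemma lift_stable c c' f f' : lift_of c f -> lift_of c' f' ->
  (forall t, 0 <= t <= 1 -> near_lifts e (c t) (c' t)) ->
  sep (f 0) (f' 0) < e -> forall t, 0 <= t <= 1 -> sep (f t) (f' t) < e.
Proof.
move=> [cf uf] [cf' uf'] cc' s0.
have [d d0 hd] := uf e e0; have [d' d'0 hd'] := uf' e e0.
apply: (@unit_interval_ind _ (Num.min d d')) => [|//|s t s_ge0 st t_le1].
  by rewrite lt_min d0.
rewrite lt_min => /andP[std std'] ss.
have s01 : 0 <= s <= 1 by rewrite s_ge0 (le_trans st).
have t01 : 0 <= t <= 1 by rewrite t_le1 (le_trans s_ge0).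
have abs_st : `|s - t| = t - s by rewrite distrC ger0_norm// subr_ge0.
have := cc' t t01; rewrite -cf// => /near_lifts_from[w wt fw].
suff <- : w = f' t by [].
apply: (@near_chain_eq _ (f t) (f s) (f' s)) => //.
- by rewrite wt cf'.
- by rewrite sepC.
- by rewrite sepC; apply: hd => //; rewrite abs_st.
- by apply: hd' => //; rewrite abs_st.
Qed.

Lemma lift_unique c f f' : lift_of c f -> lift_of c f' -> f 0 = f' 0 ->
  forall t, 0 <= t <= 1 -> f t = f' t.
Proof.
move=> cf cf' ff' t t01; apply: hproj_inj_near.
  by rewrite (cf.1 t t01) (cf'.1 t t01).
have : sep (f t) (f' t) < e.
  apply: (lift_stable cf cf') => [s s01||//]; last by rewrite ff' sepzz.
  by exists (f s), (f s); split; rewrite ?(cf.1 s s01)// sepzz.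
by move: e0; lra.
Qed.

Lemma lift_exists c z : uniform_surface_path c -> hproj z = c 0 ->
  exists2 f, lift_of c f & f 0 = z.
Proof.
move=> uc zc; have [d d0 hd] := uc e e0.
pose T z q := xget z [set w | hproj w = q /\ sep z w < e].
have TP w q : near_lifts e (hproj w) q -> hproj (T w q) = q /\ sep w (T w q) < e.
  move=> /near_lifts_from[w' h1 h2].
  by rewrite /T; case: xgetP => [w'' -> //|/(_ w')[]].
pose step := d / 2; have step0 : 0 < step by rewrite /step; lra.
pose clip (k : nat) := Num.min 1 (k%:R * step).
have clip01 k : 0 <= clip k <= 1.
  by rewrite /clip le_min ler01 ge_min lexx mulr_ge0// ltW.
have clip_step k : `|clip k - clip k.+1| < d.
  rewrite /clip -natr1 mulrDl mul1r distrC.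
  have := mulr_ge0 (ler0n R k) (ltW step0).
  move: (k%:R * step) => x x0; rewrite /step in step0 *.
  by case: (leP 1 x) => ?; case: (leP 1 (x + d / 2)) => ?; rewrite ger0_norm; lra.
(* The lifts at the points of the subdivision; every other time is lifted next
   to the preceding point of the subdivision. *)
pose g := fix g (k : nat) := if k is k'.+1 then T (g k') (c (clip k)) else z.
have gP k : hproj (g k) = c (clip k) /\ sep (g k) (g k.+1) < e.
  elim: k => [|k [IH1 IH2]].
    have z0 : hproj z = c (clip 0%N) by rewrite zc /clip mul0r min_r// ler01.
    split=> //=; apply: (TP _ _ _).2; rewrite z0; exact: hd.
  have p1 : hproj (g k.+1) = c (clip k.+1).
    by apply: (TP _ _ _).1; rewrite IH1; exact: hd.
  by split=> //; apply: (TP _ _ _).2; rewrite p1; exact: hd.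
pose idx t := Num.truncn (t / step).
pose f t := T (g (idx t)) (c t).
have idxP t : 0 <= t <= 1 -> (idx t)%:R * step <= t < (idx t)%:R * step + step.
  move=> /andP[t0 _].
  have /truncn_itv/andP[] : 0 <= t / step by rewrite divr_ge0// ltW.
  rewrite -/(idx t) ler_pdivlMr// ltr_pdivrMr// -natr1 mulrDl mul1r.
  by move=> -> ->.
have fP t : 0 <= t <= 1 -> hproj (f t) = c t /\ sep (g (idx t)) (f t) < e.
  move=> t01; apply: TP; rewrite (gP _).1; apply: hd => //.
  have /andP[t0 t1] := idxP t t01; move: t0 t1 t01.
  rewrite /clip; move: (_ * step) => x; rewrite /step in step0 * => ? ? /andP[? ?].
  by case: (leP 1 x) => ?; rewrite distrC ger0_norm; lra.
have f_near r s t : 0 < r -> r <= e -> 0 <= s -> s <= t -> t <= 1 ->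
    t - s < step -> near_lifts r (c s) (c t) -> sep (f s) (f t) < r.
  move=> r0 re s0 st t1 tss; have s01 : 0 <= s <= 1 by rewrite s0 (le_trans st).
  have t01 : 0 <= t <= 1 by rewrite t1 (le_trans s0).
  have [fs1 fs2] := fP s s01; have [ft1 ft2] := fP t t01.
  rewrite -fs1 => /near_lifts_from[w wt fw].
  suff <- : w = f t by [].
  apply: (@near_chain_eq _ (f s) (g (idx s)) (g (idx t))) => //.
  - by rewrite wt ft1.
  - by rewrite sepC (lt_le_trans fw).
  - by rewrite sepC.
  have : (idx t == idx s) || (idx t == (idx s).+1).
    have /andP[i1 i2] := idxP s s01; have /andP[j1 j2] := idxP t t01.
    have lo : (idx s <= idx t)%N by apply: le_truncn; rewrite ler_pM2r ?invr_gt0.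
    have hi : (idx t < (idx s).+2)%N.
      rewrite -(ltr_nat R) -(ltr_pM2r step0) -addn2 natrD mulrDl.
      have aux (x y h s' t' : R) : s' < x + h -> y <= t' -> t' - s' < h ->
        y < x + 2 * h by lra.
      exact: aux i2 j1 tss.
    move: hi; rewrite ltnS leq_eqVlt => /orP[->|]; first by rewrite orbT.
    by rewrite ltnS eqn_leq lo andbT => ->.
  case/orP => /eqP ->; last exact: (gP _).2.
  by rewrite sepzz.
exists f; last first.
  have [f01 f02] : hproj (f 0) = c 0 /\ sep (g (idx 0)) (f 0) < e.
    by apply: fP; rewrite lexx ler01.
  apply: hproj_inj_near; first by rewrite f01.
  have -> : z = g (idx 0) by rewrite /idx mul0r truncn0.
  by rewrite sepC; move: f02 e0; lra.
split=> [t /fP[]//|r r0].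
have [d' d'0 hd'] := uc (Num.min r e) ltac:(by rewrite lt_min r0).
exists (Num.min d' step); first by rewrite lt_min d'0.
have wl s t : 0 <= s -> s <= t -> t <= 1 -> t - s < d' -> t - s < step ->
    sep (f s) (f t) < r.
  move=> s0 st t1 h1 h2.
  apply: (@lt_le_trans _ _ (Num.min r e)); last by rewrite ge_min lexx.
  apply: f_near => //; rewrite ?lt_min ?r0 ?ge_min ?lexx ?orbT//.
  apply: hd'; rewrite ?s0 ?t1 ?(le_trans st)//; first by rewrite (le_trans s0).
  by rewrite distrC ger0_norm// subr_ge0.
move=> s t /andP[s0 s1] /andP[t0 t1]; rewrite lt_min => /andP[h1 h2].
have [st|/ltW ts] := leP s t.
  by apply: wl => //; move: h1 h2; rewrite distrC ger0_norm// subr_ge0.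
by rewrite sepC; apply: wl => //; move: h1 h2; rewrite ger0_norm// subr_ge0.
Qed.

End path_lifting.

Section fundamental_group_lifts.
Context {R : realType} (G : surface_group R) (e : R).
Hypotheses (e0 : 0 < e) (e1 : 12 * e <= 1).
Hypothesis deck_far : forall z M, deck G M -> M <> 1%g -> M <> SL2_opp 1%g ->
  144 * e < sep z (hact M z).
Implicit Types (z w : hplane R) (M : SL2 R) (p q : surface G).
Implicit Types (c : R -> surface G) (f : R -> hplane R).
Local Notation hproj := (@hproj R G).

Lemma continuous_uniform_surface_path c :
  {within `[0, 1], continuous c} -> uniform_surface_path c.
Proof.
move=> cc r r0.
have [d d0 hd] := compact_near_lifts r0 (@segment_compact R 0 1) cc.
exists d => // s t s01 t01 st; apply: hd => //=; rewrite in_itv/=; assumption.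
Qed.

(** The end of the lift of an intermediate loop is a lift of p which moves by
less than e when the parameter of the homotopy changes a little; it is
therefore constant. *)
Lemma homotopic_lift_end p c c' f f' :
  homotopic p c c' -> lift_of c f -> lift_of c' f' -> f 0 = f' 0 -> f 1 = f' 1.
Proof.
move=> [F [cF Fc Fp]] cf cf' ff'.
have K2 : compact (`[0, 1] `*` `[0, 1] : set (R * R)).
  by apply: compact_setX; exact: segment_compact.
have inI (x : R) : 0 <= x <= 1 -> (`[0, 1]%classic : set R) x by rewrite /= in_itv.
have uF (r : R) : 0 < r -> exists2 d : R, 0 < d & forall s t s' t',
    0 <= s <= 1 -> 0 <= t <= 1 -> 0 <= s' <= 1 -> 0 <= t' <= 1 ->
    `|s - s'| < d -> `|t - t'| < d -> near_lifts r (F (s, t)) (F (s', t')).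
  move=> r0; have [d d0 hd] := compact_near_lifts r0 K2 cF.
  exists d => // s t s' t' hs ht hs' ht' ss' tt'; apply: hd.
  - by split; apply: inI.
  - by split; apply: inI.
  - by split.
have u_slice s : 0 <= s <= 1 -> uniform_surface_path (fun t => F (s, t)).
  move=> s01 r /uF[d d0 hd]; exists d => // t t' *.
  by apply: hd => //; rewrite subrr normr0.
have z01 : 0 <= (0 : R) <= 1 by rewrite lexx ler01.
have o01 : 0 <= (1 : R) <= 1 by rewrite lexx ler01.
have f0p s : 0 <= s <= 1 -> hproj (f 0) = F (s, 0).
  move=> s01; rewrite (Fp s _).1 ?in_itv// -(Fp 0 _).1 ?in_itv//.
  by rewrite (Fc 0 _).1 ?in_itv//; exact: cf.1.
have [d d0 hd] := uF e e0.
have cf0 : lift_of (fun t => F (0, t)) f.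
  by split=> [t t01|]; [rewrite (cf.1 t t01) (Fc t _).1 ?in_itv|exact: cf.2].
have cf1 : lift_of (fun t => F (1, t)) f'.
  by split=> [t t01|]; [rewrite (cf'.1 t t01) (Fc t _).2 ?in_itv|exact: cf'.2].
have step : forall s, 0 <= s <= 1 ->
    forall g, lift_of (fun t => F (s, t)) g -> g 0 = f 0 -> g 1 = f 1.
  apply: (unit_interval_ind d0) => [g lg g0|s t s0 st t1 std IH g lg g0].
    exact: (lift_unique e0 e1 deck_far lg cf0 g0).
  have s01 : 0 <= s <= 1 by rewrite s0 (le_trans st).
  have t01 : 0 <= t <= 1 by rewrite t1 (le_trans s0).
  have [g' lg' g'0] := lift_exists e0 e1 deck_far (u_slice s s01) (f0p s s01).
  rewrite -(IH g' lg' g'0); apply/esym/(hproj_inj_near deck_far).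
    by rewrite (lg.1 1 o01) (lg'.1 1 o01) !(Fp _ _).2 ?in_itv.
  have : sep (g' 1) (g 1) < e.
    apply: (lift_stable e0 e1 deck_far lg' lg) o01; last first.
      by rewrite g'0 g0 sepzz.
    move=> x x01; apply: hd; rewrite ?subrr ?normr0//.
    by rewrite distrC ger0_norm// subr_ge0.
  by move: e0; lra.
by rewrite (step 1 o01 f').
Qed.

Section subgroup_lifts.
Context (z : hplane R) (H : set (SL2 R)).
Hypotheses (HG : H `<=` deck G) (H1 : H 1%g).
Hypothesis HM : forall M N, H M -> H N -> H (M * N)%g.
Hypothesis HV : forall M, H M -> H M^-1%g.

Definition lifts_into c := exists f, [/\ lift_of c f, f 0 = z &
  exists2 M, H M & f 1 = hact M z].

Lemma lift_hact M c f : deck G M -> lift_of c f ->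
  lift_of c (fun t => hact M (f t)).
Proof.
move=> GM [cf uf]; split=> [t t01|r /uf[d d0 hd]].
  by rewrite hproj_hact// cf.
by exists d => // s t *; rewrite sep_hact; exact: hd.
Qed.

Lemma lift_inv c f : lift_of c f -> lift_of (loop_inv c) (fun t => f (1 - t)).
Proof.
have flip01 (t : R) : 0 <= t <= 1 -> 0 <= 1 - t <= 1.
  by move=> /andP[? ?]; apply/andP; split; lra.
move=> [cf uf]; split=> [t /flip01/cf//|r /uf[d d0 hd]].
exists d => // s t s01 t01 st; apply: hd; rewrite ?flip01//.
by rewrite opprD addrACA subrr add0r addrC opprK distrC.
Qed.

(** Two times on different sides of 1/2 are compared through the common value f
1 = f' 0. *)
Lemma lift_mul c c' f f' : lift_of c f -> lift_of c' f' -> f 1 = f' 0 ->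
  lift_of (loop_mul c c')
    (fun t => if t <= 2^-1 then f (2 * t) else f' (2 * t - 1)).
Proof.
have lo01 (t : R) : 0 <= t <= 1 -> t <= 2^-1 -> 0 <= 2 * t <= 1.
  by move=> /andP[? ?] ?; apply/andP; split; lra.
have hi01 (t : R) : 0 <= t <= 1 -> 2^-1 < t -> 0 <= 2 * t - 1 <= 1.
  by move=> /andP[? ?] ?; apply/andP; split; lra.
have z01 : 0 <= (0 : R) <= 1 by rewrite lexx ler01.
have o01 : 0 <= (1 : R) <= 1 by rewrite lexx ler01.
move=> [cf uf] [cf' uf'] ff'; split=> [t t01|r r0].
  rewrite /loop_mul; case: leP => t2; first by rewrite cf// lo01.
  by rewrite cf'// hi01.
pose r' := Num.min 1 (r / 13).
have r'0 : 0 < r' by rewrite lt_min ltr01 divr_gt0.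
have r'1 : r' <= 1 by rewrite ge_min lexx.
have r'r : r' <= r / 13 by rewrite ge_min lexx orbT.
have [d d0 hd] := uf r' r'0; have [d' d'0 hd'] := uf' r' r'0.
have dd0 : 0 < Num.min d d' / 2 by rewrite divr_gt0// lt_min d0.
exists (Num.min d d' / 2) => //.
have dm : Num.min d d' <= d by rewrite ge_min lexx.
have dm' : Num.min d d' <= d' by rewrite ge_min lexx orbT.
move: (Num.min d d') dd0 dm dm' => m m0 md md'.
suff wl s t : 0 <= s <= 1 -> 0 <= t <= 1 -> s <= t -> t - s < m / 2 ->
    sep (if s <= 2^-1 then f (2 * s) else f' (2 * s - 1))
        (if t <= 2^-1 then f (2 * t) else f' (2 * t - 1)) < r.
  move=> s t s01 t01; have [st|/ltW ts] := leP s t.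
    by rewrite distrC ger0_norm ?subr_ge0//; exact: wl.
  by rewrite ger0_norm ?subr_ge0// sepC; exact: wl.
move=> s01 t01 st dst.
have absd (x y : R) : x <= y -> `|x - y| = y - x.
  by move=> xy; rewrite distrC ger0_norm// subr_ge0.
have [s2|s2] := leP s 2^-1; have [t2|t2] := leP t 2^-1.
- apply: (@lt_trans _ _ r'); last by lra.
  by apply: hd; rewrite ?lo01// absd; lra.
- have h1 : sep (f (2 * s)) (f 1) < r'.
    by apply: hd; rewrite ?lo01// absd; lra.
  have h2 : sep (f' 0) (f' (2 * t - 1)) < r'.
    by apply: hd'; rewrite ?hi01// absd; lra.
  rewrite ff' in h1.
  by have := sep_weak_triangle (ltW h1) (ltW h2) r'1 r'1; lra.
- by lra.
- apply: (@lt_trans _ _ r'); last by lra.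
  by apply: hd'; rewrite ?hi01// absd; lra.
Qed.

(** The loops whose lift from z ends in the orbit of z under a subgroup H form
a subgroup of the fundamental group: a product lifts to the lift of its first
factor followed by a translate of the lift of the second one, and homotopic
loops have lifts with the same end. *)
Lemma pi1_generated_lifts_into (A : set (R -> surface G)) :
  (forall c, A c -> lifts_into c) ->
  forall c, pi1_generated (hproj z) A c -> lifts_into c.
Proof.
move=> HA c; elim=> {c} [c /HA //||c c' _ IH _ IH'|c _ IH|c c' _ IH lc' cc'].
- exists (fun=> z); split=> //; last by exists 1%g => //; rewrite hact1.
  by split=> // r r0; exists 1 => // s t *; rewrite sepzz.
- have [f [cf f0 [M HM1 f1]]] := IH; have [f' [cf' f'0 [N HN f'1]]] := IH'.
  have lN := lift_hact (HG HM1) cf'.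
  exists (fun t => if t <= 2^-1 then f (2 * t) else hact M (f' (2 * t - 1))).
  split; first by apply: (lift_mul cf lN); rewrite f1 f'0.
    by rewrite invr_ge0 ler0n mulr0.
  exists (M * N)%g; first exact: HM.
  have -> : (1 <= 2^-1 :> R) = false by apply/negbTE; rewrite -ltNge; lra.
  have -> : 2 * 1 - 1 = 1 :> R by lra.
  by rewrite f'1 hactM.
- have [f [cf f0 [M HM1 f1]]] := IH.
  exists (fun t => hact M^-1%g (f (1 - t))); split.
  + by apply: lift_hact; [apply: HG; exact: HV|exact: lift_inv].
  + by rewrite subr0 f1 -hactM mulVg hact1.
  + by exists M^-1%g; [exact: HV|rewrite subrr f0].
- have [f [cf f0 [M HM1 f1]]] := IH; have [cc0 c'0 c'1] := lc'.
  have [f' cf' f'0] := lift_exists e0 e1 deck_far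
    (continuous_uniform_surface_path cc0) (esym c'0).
  exists f'; split=> //; exists M => //.
  by rewrite -f1; apply/esym/(homotopic_lift_end cc' cf cf'); rewrite f0 f'0.
Qed.

End subgroup_lifts.

(** The path from z to w which is affine in the coordinates. The maximum only
matters outside the unit interval, where the affine path leaves the half-plane.
*)
Definition segment_val z w (t : R) : R[i] := Complex (hx z + t * (hx w - hx z))
  (Num.max (hy z + t * (hy w - hy z)) (Num.min (hy z) (hy w))).
Fact segment_subproof z w t : 0 < complex.Im (segment_val z w t).
Proof. by rewrite /= lt_max lt_min !hy_gt0 orbT. Qed.
Definition segment z w t : hplane R :=
  Sub (segment_val z w t) (segment_subproof z w t).

Lemma segmentE z w t : 0 <= t <= 1 ->
  [/\ hx (segment z w t) = hx z + t * (hx w - hx z),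
      hy (segment z w t) = hy z + t * (hy w - hy z) &
      Num.min (hy z) (hy w) <= hy (segment z w t)].
Proof.
move=> /andP[t0 t1]; split=> //; rewrite {1}/hy /= ?le_max ?lexx ?orbT//.
rewrite max_l// ge_min.
have [zw|/ltW wz] := leP (hy z) (hy w); first by rewrite lerDl mulr_ge0// subr_ge0.
by apply/orP; right; nra.
Qed.

Lemma segment_continuous z w : continuous (segment z w).
Proof.
apply: (@continuous_comp_initial _ _ _ (@hplane_coord R)) => t.
have cst (k : R) : (fun=> k : R) @ t --> k by exact: cvg_cst.
have aff (a b : R) : (a + s * (b - a)) @[s --> t] --> a + t * (b - a).
  by apply: cvgD => //; apply: cvgM.
have cx := aff (hx z) (hx w); have cy := aff (hy z) (hy w).
have cm : Num.max (hy z + s * (hy w - hy z)) (Num.min (hy z) (hy w)) @[s --> t]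
    --> Num.max (hy z + t * (hy w - hy z)) (Num.min (hy z) (hy w)).
  apply: (@continuous_max _ _ (fun s : R => hy z + s * (hy w - hy z))
    (fun=> Num.min (hy z) (hy w))); first exact: cy.
  exact: cst.
exact: (cvg_pair cx cm).
Qed.

Lemma segment_lift z w : lift_of (fun t => hproj (segment z w t)) (segment z w).
Proof.
split=> // r r0; set m := Num.min (hy z) (hy w).
have m0 : 0 < m by rewrite lt_min !hy_gt0.
pose K := ((hx w - hx z) ^+ 2 + (hy w - hy z) ^+ 2) / m ^+ 2.
have K0 : 0 <= K by rewrite divr_ge0 ?addr_ge0 ?sqr_ge0.
pose d := Num.min 1 (r / (K + 1)).
have rK0 : 0 < r / (K + 1) by rewrite divr_gt0//; lra.
exists d => [|s t s01 t01]; first by rewrite lt_min ltr01.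
rewrite lt_min => /andP[h1]; rewrite ltr_pdivlMr; last by lra.
move=> h2; have [es1 es2 es3] := segmentE z w s01.
have [et1 et2 et3] := segmentE z w t01.
rewrite -/m in es3 et3.
apply: (@le_lt_trans _ _ (K * (s - t) ^+ 2)).
  rewrite /sep ler_pdivrMr ?mulr_gt0 ?hy_gt0// es1 et1 es2 et2.
  rewrite es2 in es3; rewrite et2 in et3.
  have -> : (hx z + s * (hx w - hx z) - (hx z + t * (hx w - hx z))) ^+ 2 +
    (hy z + s * (hy w - hy z) - (hy z + t * (hy w - hy z))) ^+ 2 =
    K * (s - t) ^+ 2 * m ^+ 2.
    by rewrite /K; field; rewrite gt_eqF.
  apply: ler_wpM2l; first by rewrite mulr_ge0 ?sqr_ge0.
  by rewrite expr2; apply: ler_pM => //; exact: ltW.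
have a0 := normr_ge0 (s - t); rewrite -[(s - t) ^+ 2]real_normK ?num_real//.
by move: (`|s - t|) a0 h1 h2 => x *; nra.
Qed.

Lemma segment0 z w : segment z w 0 = z.
Proof.
have [h1 h2 _] := @segmentE z w 0 ltac:(by rewrite lexx ler01).
by apply: hplaneP; rewrite ?h1 ?h2 mul0r addr0.
Qed.

Lemma segment1 z w : segment z w 1 = w.
Proof.
have [h1 h2 _] := @segmentE z w 1 ltac:(by rewrite lexx ler01).
by apply: hplaneP; rewrite ?h1 ?h2 mul1r addrC subrK.
Qed.

Lemma segment_loop z M : deck G M ->
  is_loop (hproj z) (fun t => hproj (segment z (hact M z) t)).
Proof.
move=> GM; split.
- apply: continuous_subspaceT => t.
  apply: (@continuous_comp _ _ _ (segment z (hact M z)) hproj).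
    exact: segment_continuous.
  exact: hproj_continuous.
- by rewrite segment0.
- by rewrite segment1 hproj_hact.
Qed.

Lemma loop_lift_end z c : is_loop (hproj z) c -> exists f,
  [/\ lift_of c f, f 0 = z & exists2 M, deck G M & f 1 = hact M z].
Proof.
move=> [cc c0 c1].
have [f cf f0] := lift_exists e0 e1 deck_far (continuous_uniform_surface_path cc) (esym c0).
exists f; split=> //; apply/hproj_eqP.
by rewrite cf.1 ?ler01 ?lexx.
Qed.

(** Finitely many loops determine finitely many deck transformations. If these
lie in a subgroup which omits N and - N, for some deck transformation N, then
the loop of N is not generated by the given ones. *)
Lemma not_pi1_finitely_generated z :
  (forall n (M : 'I_n -> SL2 R), (forall i, deck G (M i)) ->
    exists H : set (SL2 R), [/\ H `<=` deck G, H 1%g,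
      forall M N, H M -> H N -> H (M * N)%g, forall M, H M -> H M^-1%g &
      (forall i, H (M i)) /\ exists2 N, deck G N &
      ~ H N /\ ~ H (SL2_opp N)]) ->
  ~ @pi1_finitely_generated R (surface G) (hproj z).
Proof.
move=> ext [n [a [la gen]]].
have /choice[M HM] i : exists M, deck G M /\ exists f,
    [/\ lift_of (a i) f, f 0 = z & f 1 = hact M z].
  have [f [h1 h2 [M GM h3]]] := loop_lift_end (la i).
  by exists M; split=> //; exists f.
have [H [HG H1 HMul HV [HMi [N GN [nHN nHoN]]]]] :=
  ext n M (fun i => (HM i).1).
have Ha c : range a c -> lifts_into z H c.
  move=> [i _ <-]; have [_ [f [h1 h2 h3]]] := HM i.
  by exists f; split=> //; exists (M i).
have [f [cf f0 [P HP f1]]] := pi1_generated_lifts_into HG H1 HMul HV Ha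
  (gen _ (segment_loop z GN)).
have : hact N z = hact P z.
  rewrite -f1 -(segment1 z (hact N z)).
  apply: (lift_unique e0 e1 deck_far (segment_lift z (hact N z)) cf).
    by rewrite segment0 f0.
  by rewrite ler01 lexx.
move=> /(congr1 (hact P^-1%g)); rewrite -!hactM mulVg hact1 => fixz.
have GP := HG _ HP.
have GPN : deck G (P^-1 * N)%g by exact: deckVM.
have [e2|e2] := deck_no_elliptic GPN fixz.
  by apply: nHN; rewrite -[N](mulKg P^-1%g) e2 invgK mulg1.
apply: nHoN; suff -> : SL2_opp N = P by [].
by rewrite -[N](mulKg P^-1%g) e2 invgK SL2_oppMr SL2_oppK mulg1.
Qed.

End fundamental_group_lifts.

(** * The Schottky surface *)
Section schottky_group.
Context {R : realType} (S : schottky R).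

Definition schottky_deck : set (SL2 R) :=
  [set M | exists w, M = word S w \/ M = SL2_opp (word S w)].

Lemma schottky_trace M : schottky_deck M ->
  [\/ M = 1%g, M = SL2_opp 1%g | 3 <= `|tr2 M|].
Proof.
move=> [w [->|->]]; have [e|tr3] := trace_word S w.
- by rewrite e; exact: Or31.
- exact: Or33.
- by rewrite e; exact: Or32.
- by apply: Or33; rewrite tr2N normrN.
Qed.

Lemma schottky_deck1 : schottky_deck 1%g.
Proof. by exists [::]; left; rewrite word_nil. Qed.

Lemma schottky_deckVM M N :
  schottky_deck M -> schottky_deck N -> schottky_deck (M^-1 * N)%g.
Proof.
move=> [v hv] [w hw]; exists (rev (map flip v) ++ w).
rewrite word_cat word_rev_flip.
case: hv hw => -> [] ->; rewrite ?SL2_oppV ?SL2_oppMl ?SL2_oppMr ?SL2_oppK;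
  by [left|right].
Qed.

Lemma schottky_deckN1 : schottky_deck (SL2_opp 1%g).
Proof. by exists [::]; right; rewrite word_nil. Qed.

Lemma SL2_entry_continuous i j : continuous (fun M : SL2 R => SL2_val M i j).
Proof.
move=> M; apply: (@continuous_comp _ _ _ (@SL2_val R) (fun A => A i j)).
  exact: (@initial_continuous _ _ (@SL2_val R)).
exact: coord_continuous.
Qed.

Lemma tr2_cvg (T : topologicalType) (f g : T -> R) (a b : R) t :
  continuous f -> continuous g ->
  (a * f s + b * g s) @[s --> t] --> a * f t + b * g t.
Proof.
by move=> cf cg; apply: cvgD; apply: cvgM; [exact: cvg_cst|exact: cf|
  exact: cvg_cst|exact: cg].
Qed.

Lemma tr2_continuous M : continuous (fun N : SL2 R => tr2 (M * N)%g).
Proof.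
move=> N.
have -> : (fun N : SL2 R => tr2 (M * N)%g) = (fun N =>
    (ea M * ea N + eb M * ec N) + (ec M * eb N + ed M * ed N)).
  by apply/funext => P; rewrite /tr2; have [-> _ _ ->] := SL2_mulE M P.
exact: (@cvgD _ _ (SL2 R : topologicalType) _ _ _ _ _ _
  (@tr2_cvg (SL2 R : topologicalType) _ _ (ea M) (eb M) N
    (@SL2_entry_continuous 0 0) (@SL2_entry_continuous 1 0))
  (@tr2_cvg (SL2 R : topologicalType) _ _ (ec M) (ed M) N
    (@SL2_entry_continuous 0 1) (@SL2_entry_continuous 1 1))).
Qed.

(** The trace is continuous, equals 2 at 1, and has modulus at least 3
elsewhere on the group, except for the value - 2 at - 1. *)
Lemma schottky_discrete M : schottky_deck M -> isolated schottky_deck M.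
Proof.
move=> GM; split; first exact: mem_set.
exists [set N | `|2 - tr2 (M^-1 * N)%g| < 1].
  have := @tr2_continuous M^-1%g M; rewrite /continuous_at mulVg tr2_1.
  by move/cvgrPdist_lt => /(_ 1 ltr01).
have far (x : R) : `|2 - x| < 1 -> x <> - 2 /\ ~~ (3 <= `|x|).
  rewrite ltr_norml => /andP[h1 h2]; split; first lra.
  by rewrite -ltNge ltr_norml; apply/andP; split; lra.
apply/seteqP; split=> [N [/= /far[h1 h2] GN]|N ->]; last first.
  by split=> //=; rewrite mulVg tr2_1 subrr normr0.
have [e|e|tr3] := schottky_trace (schottky_deckVM GM GN).
- by rewrite /= -[N](mulKg M^-1%g) e invgK mulg1.
- by exfalso; apply: h1; rewrite e tr2N tr2_1.
- by move: h2; rewrite tr3.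
Qed.

Lemma schottky_sep M z : schottky_deck M -> M <> 1%g -> M <> SL2_opp 1%g ->
  5 <= sep z (hact M z).
Proof.
move=> /schottky_trace[//|//|tr3] _ _; apply: le_trans (sep_trace M z).
by rewrite -real_normK ?num_real//; nra.
Qed.

Lemma schottky_no_elliptic M z : schottky_deck M -> hact M z = z ->
  M = 1%g \/ M = SL2_opp 1%g.
Proof.
move=> GM fz; have [?|n1] := pselect (M = 1%g); first by left.
have [?|nN1] := pselect (M = SL2_opp 1%g); first by right.
exfalso; have := schottky_sep z GM n1 nN1; rewrite fz sepzz {GM n1 nN1 fz}.
lra.
Qed.

Definition schottky_group : surface_group R :=
  SurfaceGroup schottky_deck1 schottky_deckVM schottky_deckN1 schottky_discrete
    schottky_no_elliptic.

Lemma schottky_ed_ge1 M : schottky_deck M -> 1 <= `|ed M|.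
Proof.
move=> [w [->|->]]; first exact: word_ed_ge1.
by have [_ _ _ ->] := SL2_oppE (word S w); rewrite normrN word_ed_ge1.
Qed.

Lemma schottky_gen n : schottky_deck (gen S n).
Proof.
by exists [:: (n, true)]; left; rewrite word_cons word_nil mulg1.
Qed.

Lemma schottky_inj_radius :
  exists2 C : R, 0 < C & forall p : surface schottky_group,
    (C%:E <= inj_radius p)%E.
Proof.
exists (arcosh (1 + 5 / 2)); first by rewrite arcosh_gt0//; lra.
move=> p; apply: le_ereal_inf_tmp => _ [z [M [_ GM n1 nN1 ->]]].
have := schottky_sep z GM n1 nN1; rewrite lee_fin hdist_sep {GM n1 nN1} => h.
by apply: le_arcosh; lra.
Qed.

Definition subword (N : nat) : set (SL2 R) := [set M | exists2 w,
  forall l, l \in w -> (l.1 < N)%N & M = word S w \/ M = SL2_opp (word S w)].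

Lemma schottky_geometrically_infinite : geometrically_infinite schottky_group.
Proof.
pose z : hplane R := foot (up 0 ltr01).
move=> /(_ (hproj schottky_group z)).
(* The displacement of every point is at least 5, and 144 / 30 < 5. *)
pose e : R := 1 / 30.
apply: (@not_pi1_finitely_generated _ _ e); rewrite /e; try lra.
  by move=> {}z M GM n1 nN1; have := schottky_sep z GM n1 nN1;
    clear -R; lra.
move=> n M GM; have /choice[w hw] i : exists w, M i = word S w \/
  M i = SL2_opp (word S w) by exact: GM.
pose N := (\max_(i < n) \max_(l <- w i) l.1).+1.
exists (subword N); split.
- by move=> P [v _ hv]; exists v.
- by exists [::] => //; left; rewrite word_nil.
- move=> P Q [v lv hv] [v' lv' hv']; exists (v ++ v').
    by move=> l; rewrite mem_cat => /orP[/lv|/lv'].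
  rewrite word_cat; case: hv hv' => -> [] ->;
  rewrite ?SL2_oppMl ?SL2_oppMr ?SL2_oppK; by [left|right].
- move=> P [v lv hv]; exists (rev (map flip v)).
    by move=> l; rewrite mem_rev => /mapP[l' /lv + ->].
  rewrite word_rev_flip; case: hv => ->;
  rewrite ?SL2_oppV; by [left|right].
split=> [i|].
  exists (w i) => // l lw; rewrite ltnS.
  apply: leq_trans (leq_bigmax i).
  by rewrite (big_rem l lw)/= leq_maxl.
exists (gen S N); first exact: schottky_gen.
split=> -[v lv hv]; have [n1 n2] := word_gen_independent S lv.
  by case: hv => hv; [exact: n1 (esym hv)|apply: n2; rewrite hv SL2_oppK].
case: hv => hv; [exact: n2 (esym hv)|apply: n1].
by rewrite -[LHS]SL2_oppK -hv SL2_oppK.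
Qed.

End schottky_group.

(** * The vertical ray and its horocycle *)
Section flow_at_infinity.
Local Open Scope quotient_scope.
Context {R : realType}.

Definition up_i : unit_hplane R := up 0 ltr01.

Lemma tact_up_i_coord (M : SL2 R) : let n := ec M ^+ 2 + ed M ^+ 2 in
  unit_hplane_coord (tact M up_i) =
  (((eb M * ed M + ea M * ec M) / n, 1 / n),
   (2 * ec M * ed M / n ^+ 2, (ed M ^+ 2 - ec M ^+ 2) / n ^+ 2)).
Proof.
have := cnorm_gt0 M (foot up_i); have := SL2_detE M.
rewrite /cnorm /hx /hy /hplane_coord /= mulr0 add0r mulr1.
rewrite /unit_hplane_coord /= /mobius /cocycle /SL2_val.
move: (val M 0 0) (val M 0 1) (val M 1 0) (val M 1 1) => a b c d dM n0.
rewrite [d ^+ 2 + _]addrC in n0; have n1 := lt0r_neq0 n0.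
have e1 : d * d + c ^+ 2 = c ^+ 2 + d ^+ 2 by ring.
have e2 : (d * d - c * c) ^+ 2 + (d * c + c * d) ^+ 2 =
  (c ^+ 2 + d ^+ 2) ^+ 2 by ring.
rewrite expr2; simpc; rewrite /= e1 e2.
congr ((_, _), (_, _)); [by field| |by field].
by rewrite -[RHS]mul1r -dM; field.
Qed.

(** The coordinates of the image of the upward vector at i, as a rational
function of the matrix entries; squares are spelled out as products to match
the lemmas on limits. *)
Let polar (M : (R * R) * (R * R)) : (R * R) * (R * R) :=
  let n := M.2.1 * M.2.1 + M.2.2 * M.2.2 in
  (((M.1.2 * M.2.2 + M.1.1 * M.2.1) * n^-1, n^-1),
   ((M.2.1 * M.2.2 + M.2.1 * M.2.2) * (n * n)^-1,
    (M.2.2 * M.2.2 - M.2.1 * M.2.1) * (n * n)^-1)).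

Let entries (M : SL2 R) := ((ea M, eb M), (ec M, ed M)).

Let polarE M : polar (entries M) = unit_hplane_coord (tact M up_i).
Proof.
rewrite tact_up_i_coord /polar /entries /= !expr2 mul1r.
by congr ((_, _), (_ / _, _)); ring.
Qed.

Let polar_cvg M : {for entries M, continuous polar}.
Proof.
have n0 : ec M * ec M + ed M * ed M != 0.
  have := cnorm_gt0 M (foot up_i).
  by rewrite /cnorm /hx /hy /= mulr0 add0r mulr1 addrC !expr2 => /lt0r_neq0.
move: (entries M) (n0 : (entries M).2.1 * (entries M).2.1 +
  (entries M).2.2 * (entries M).2.2 != 0) => p {}n0.
have c11 : x.1.1 @[x --> p] --> p.1.1.
  by apply: cvg_comp; [exact: cvg_fst|exact: cvg_fst].
have c12 : x.1.2 @[x --> p] --> p.1.2.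
  by apply: cvg_comp; [exact: cvg_fst|exact: cvg_snd].
have c21 : x.2.1 @[x --> p] --> p.2.1.
  by apply: cvg_comp; [exact: cvg_snd|exact: cvg_fst].
have c22 : x.2.2 @[x --> p] --> p.2.2.
  by apply: cvg_comp; [exact: cvg_snd|exact: cvg_snd].
pose n (x : (R * R) * (R * R)) := x.2.1 * x.2.1 + x.2.2 * x.2.2.
have cn : n x @[x --> p] --> n p by apply: cvgD; apply: cvgM.
have cnV : (n x)^-1 @[x --> p] --> (n p)^-1 by apply: cvgV.
have cnnV : (n x * n x)^-1 @[x --> p] --> (n p * n p)^-1.
  by apply: cvgV; [rewrite mulf_neq0|exact: cvgM].
have cx : (x.1.2 * x.2.2 + x.1.1 * x.2.1) * (n x)^-1 @[x --> p] -->
    (p.1.2 * p.2.2 + p.1.1 * p.2.1) * (n p)^-1.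
  by apply: cvgM => //; apply: cvgD; apply: cvgM.
have cv : (x.2.1 * x.2.2 + x.2.1 * x.2.2) * (n x * n x)^-1 @[x --> p] -->
    (p.2.1 * p.2.2 + p.2.1 * p.2.2) * (n p * n p)^-1.
  by apply: cvgM => //; apply: cvgD; apply: cvgM.
have cw : (x.2.2 * x.2.2 - x.2.1 * x.2.1) * (n x * n x)^-1 @[x --> p] -->
    (p.2.2 * p.2.2 - p.2.1 * p.2.1) * (n p * n p)^-1.
  by apply: cvgM => //; apply: cvgB; apply: cvgM.
exact: (cvg_pair (cvg_pair cx cnV) (cvg_pair cv cw)).
Qed.

Lemma tact_up_i_near (M : SL2 R) (V : set (unit_hplane R)) :
  nbhs (tact M up_i) V -> exists2 r : R, 0 < r &
  forall N, `|ea M - ea N| < r -> `|eb M - eb N| < r -> `|ec M - ec N| < r ->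
  `|ed M - ed N| < r -> V (tact N up_i).
Proof.
move=> [U [[W oW <-]] /= WM UV].
have : nbhs (polar (entries M)) W by rewrite polarE; exact: open_nbhs_nbhs.
move=> /(polar_cvg (M := M)) /nbhs_ballP[r r0 hr].
exists r => // N ha hb hc hd; apply: UV => /=; rewrite -polarE.
exact: hr.
Qed.

End flow_at_infinity.

Definition dense_dilations (R : realType) (S : schottky R) :=
  forall lam r : R, 1 <= lam -> 0 < r ->
  exists n, `|lam - dil S n| < r /\ rate S n < r.

Section accumulating_dilations.
Local Open Scope quotient_scope.
Context {R : realType} (S : schottky R).
Hypothesis dense : dense_dilations S.
Local Notation G := (schottky_group S).
Local Notation up_i := (@up_i R).

Lemma unit_hplane_coord_inj : injective (@unit_hplane_coord R).
Proof.
move=> [[[x y] [v w]] p] [[[x' y'] [v' w']] q].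
rewrite /unit_hplane_coord /= => -[ex ey ev ew]; apply: val_inj => /=.
by rewrite ex ey ev ew.
Qed.

Fact shear_subproof (s : R) : 1 * 1 - s * 0 = 1.
Proof. by rewrite mulr1 mulr0 subr0. Qed.
Definition shear s : SL2 R := SL2_of (shear_subproof s).

Lemma tact_shear s : tact (shear s) up_i = up s ltr01.
Proof.
apply: unit_hplane_coord_inj; rewrite tact_up_i_coord.
have [-> -> -> ->] := SL2_ofE (shear_subproof s).
by rewrite /unit_hplane_coord /=; congr ((_, _), (_, _)); field.
Qed.

Fact dilation_subproof (l : R) (l0 : 0 < l) : l * l^-1 - 0 * 0 = 1.
Proof. by rewrite divff ?gt_eqF// mulr0 subr0. Qed.
Definition dilation (l : R) (l0 : 0 < l) : SL2 R :=
  SL2_of (dilation_subproof l0).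

Lemma tact_dilation (l y : R) (l0 : 0 < l) (y0 : 0 < y) : y = l ^+ 2 ->
  tact (dilation l0) up_i = up 0 y0.
Proof.
move=> yE; apply: unit_hplane_coord_inj; rewrite tact_up_i_coord.
have [-> -> -> ->] := SL2_ofE (dilation_subproof l0).
have l1 := lt0r_neq0 l0.
by rewrite /unit_hplane_coord /= yE; congr ((_, _), (_, _)); field.
Qed.

Definition tpi (u : unit_hplane R) : unit_tangent G := \pi_(unit_tangent G) u.

Lemma tpi_tact M u : deck G M -> tpi (tact M u) = tpi u.
Proof. exact: pi_tact. Qed.

Lemma frame_up_i : frame up_i = 1%g \/ frame up_i = SL2_opp 1%g.
Proof.
by apply: (@tact_up_inj R _ _ up_i); rewrite frameP tact1.
Qed.

Lemma geodesic_flow_up_i t :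
  geodesic_flow t (tpi up_i) = tpi (up 0 (expR_gt0 t)).
Proof.
rewrite /tpi geodesic_flow_pi /geodesic_lift.
by case: frame_up_i => ->; rewrite ?tactN tact1.
Qed.

Lemma horocycle_flow_up_i s : horocycle_flow s (tpi up_i) = tpi (up s ltr01).
Proof.
rewrite /tpi horocycle_flow_pi /horocycle_lift.
by case: frame_up_i => ->; rewrite ?tactN tact1.
Qed.

Lemma horocycle_flow_up s t :
  horocycle_flow t (tpi (up s ltr01)) = tpi (up (s + t) ltr01).
Proof.
rewrite -tact_shear /tpi horocycle_flow_pi horocycle_lift_tact.
have -> : horocycle_lift t up_i = up t ltr01.
  by rewrite /horocycle_lift; case: frame_up_i => ->; rewrite ?tactN tact1.
rewrite -!tact_shear -tactM; congr (\pi_(unit_tangent G) (tact _ _)).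
have [a1 b1 c1 d1] := SL2_ofE (shear_subproof s).
have [a2 b2 c2 d2] := SL2_ofE (shear_subproof t).
have [a3 b3 c3 d3] := SL2_ofE (shear_subproof (s + t)).
have [a4 b4 c4 d4] := SL2_mulE (shear s) (shear t).
by apply: SL2P; rewrite ?a4 ?b4 ?c4 ?d4 ?a1 ?b1 ?c1 ?d1 ?a2 ?b2 ?c2 ?d2 ?a3 ?b3
  ?c3 ?d3; ring.
Qed.

Lemma tpi_nbhs u (V : set (unit_tangent G)) : nbhs (tpi u) V ->
  nbhs u (tpi @^-1` V).
Proof.
by move=> /(@pi_continuous _ {eq_quot tangent_rel G} u).
Qed.

(** The product of the n-th generator with the shear by s = - b / a is the
matrix with entries a, 0, c, 1 / a, which is close to the dilation by l when a
is close to l and c to 0. The parameter s tends to - oo, being at most - 3 / c.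
*)
Lemma horocycle_approx (l T : R) (l0 : 0 < l) (V : set (unit_tangent G)) :
  1 <= l -> nbhs (tpi (tact (dilation l0) up_i)) V ->
  exists2 s, s < - T & V (horocycle_flow s (tpi up_i)).
Proof.
move=> l1 /tpi_nbhs /tact_up_i_near[r r0 hr].
pose e := Num.min r (`|T| + 1)^-1.
have T0 : 0 < `|T| + 1 by rewrite ltr_wpDl.
have e0 : 0 < e by rewrite lt_min r0 invr_gt0.
have [n [an cn]] := dense l1 e0.
have a1 := dil_gt1 S n; have c0 := rate_gt0 S n.
have ar : `|l - dil S n| < r by apply: lt_le_trans an _; rewrite ge_min lexx.
have cr : rate S n < r by apply: lt_le_trans cn _; rewrite ge_min lexx.
have cT : rate S n * (`|T| + 1) < 1.
  rewrite -ltr_pdivlMr// mul1r; apply: lt_le_trans cn _.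
  by rewrite ge_min lexx orbT.
have [Ga Gb Gc Gd] := genE S n.
have a0 : 0 < dil S n by lra.
have a00 := lt0r_neq0 a0; have c00 := lt0r_neq0 c0.
exists (- ((4 * dil S n - 1) / rate S n / dil S n)).
  rewrite ltrN2 ltr_pdivlMr// ltr_pdivlMr//.
  have Tc : rate S n * T < 1.
    by apply: le_lt_trans cT; rewrite ler_pM2l//; have := ler_norm T; lra.
  have : dil S n * (rate S n * T) < dil S n * 1 by rewrite ltr_pM2l.
  lra.
set s := - _; rewrite horocycle_flow_up_i -tact_shear -(tpi_tact _ (schottky_gen S n)).
rewrite -tactM.
have [a3 b3 c3 d3] := SL2_ofE (dilation_subproof l0).
have [a4 b4 c4 d4] := SL2_mulE (gen S n) (shear s).
have [a2 b2 c2 d2] := SL2_ofE (shear_subproof s).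
apply: hr; rewrite ?a3 ?b3 ?c3 ?d3 ?a4 ?b4 ?c4 ?d4 ?a2 ?b2 ?c2 ?d2
  ?Ga ?Gb ?Gc ?Gd.
- by rewrite mulr1 mulr0 addr0.
- have -> : dil S n * s + (4 * dil S n - 1) / rate S n * 1 = 0.
    by rewrite /s; field; rewrite ?a00 ?c00.
  by rewrite subrr normr0.
- by rewrite mulr1 mulr0 addr0 sub0r normrN gtr0_norm.
have -> : rate S n * s + 4 * 1 = (dil S n)^-1.
  by rewrite /s; field; rewrite ?a00 ?c00.
have -> : l^-1 - (dil S n)^-1 = - (l - dil S n) / (l * dil S n).
  by field; rewrite a00 lt0r_neq0.
rewrite normrM normrN normfV (gtr0_norm (mulr_gt0 l0 a0)).
apply: le_lt_trans ar; rewrite ler_pdivrMr ?mulr_gt0//.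
by rewrite ler_peMr//; nra.
Qed.

End accumulating_dilations.

Section vertical_ray.
Local Open Scope quotient_scope.
Context {R : realType} (S : schottky R).
Hypothesis dense : dense_dilations S.
Local Notation G := (schottky_group S).
Local Notation up_i := (@up_i R).
Local Notation tpi := (tpi S).

Lemma up_i_dilation : up_i = tact (dilation ltr01) up_i.
Proof. by rewrite (tact_dilation ltr01 ltr01)// expr1n. Qed.

Lemma up_expR (t : R) :
  up 0 (expR_gt0 t) = tact (dilation (expR_gt0 (t / 2))) up_i.
Proof. by rewrite (tact_dilation _ (expR_gt0 t))// expr2 -expRD -splitr. Qed.

(** The horocycle flow brings u back near itself at very negative times, hence
brings these nearby vectors to u at large positive times. *)
Lemma nonwandering_up_i : nonwandering (tpi up_i).
Proof.
move=> V Vu.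
have hs (n : nat) : exists s : R, s < - n%:R /\ V (horocycle_flow s (tpi up_i)).
  have Vu1 : nbhs (tpi (tact (dilation ltr01) up_i)) V by rewrite -up_i_dilation.
  by have [s ? ?] := horocycle_approx dense n%:R (lexx 1) Vu1; exists s.
have /choice[s sP] := hs.
exists (fun n => - s n); split.
  apply/cvgryPge => A; near=> n.
  have [+ _] := sP n; rewrite ltrNr => /ltW; apply: le_trans.
  by near: n; exact: nbhs_infty_ger.
move=> n; exists (tpi up_i); split; last exact: nbhs_singleton.
exists (horocycle_flow (s n) (tpi up_i)); first exact: (sP n).2.
by rewrite horocycle_flow_up_i horocycle_flow_up subrr.
Unshelve. all: by end_near. Qed.

Lemma geodesic_ray_closure :
  geodesic_ray (tpi up_i) `<=` closure (horocycle_orbit (tpi up_i)).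
Proof.
move=> _ [t /= t0 <-] V; rewrite geodesic_flow_up_i up_expR => Vt.
have l1 : 1 <= expR (t / 2) :> R by rewrite -[leLHS]expR0 ler_expR divr_ge0.
have [s _ Vs] := horocycle_approx dense 0 l1 Vt.
by exists (horocycle_flow s (tpi up_i)); split=> //; exists s.
Qed.

(** The height of M i is 1 / (c^2 + d^2). *)
Lemma schottky_height M : deck G M -> hy (hact M (foot up_i)) <= 1.
Proof.
move=> GM; have [_ ->] := hact_coord M (foot up_i).
rewrite {1}/hy /= mul1r invf_le1 ?cnorm_gt0// /cnorm /hx /hy /=.
have := schottky_ed_ge1 GM; rewrite mulr0 add0r mulr1 => d1.
rewrite -[ed M ^+ 2]real_normK ?num_real//.
by have := sqr_ge0 (ec M); nra.
Qed.

(** Two points at heights y <= y' are at distance at least ln (y' / y), and no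
lift of the origin of the ray is higher than 1. *)
Lemma almost_minimizing_up_i : almost_minimizing (tpi up_i).
Proof.
exists 1 => // t t0; apply: (@lt_le_trans _ _ t); first by rewrite ltrBlDr ltrDl.
rewrite geodesic_flow_up_i /tpi !base_point_pi; apply: lb_le_inf.
  by exists (hdist (foot up_i) (foot (up 0 (expR_gt0 t)))), (foot up_i),
    (foot (up 0 (expR_gt0 t))).
move=> _ [z [w [/esym /hproj_eqP[M GM ->] /esym /hproj_eqP[N GN ->] ->]]].
set v := foot (up _ _).
have -> : hdist (hact M (foot up_i)) (hact N v) =
    hdist (hact (N^-1 * M)%g (foot up_i)) v.
  by rewrite !hdist_sep -(sep_hact N^-1%g) -!hactM mulVg hact1.
have yv : hy v = expR t by [].
have h1 : hy (hact (N^-1 * M)%g (foot up_i)) <= 1.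
  by apply: schottky_height; exact: deckVM.
have y0 := hy_gt0 (hact (N^-1 * M)%g (foot up_i)).
have e1 : 1 <= expR t :> R by rewrite -[leLHS]expR0 ler_expR ltW.
apply: le_trans (hdist_ge_ln _); last by rewrite yv (le_trans h1).
rewrite yv -{1}[t]expRK ler_ln ?posrE ?expR_gt0 ?divr_gt0 ?expR_gt0//.
by rewrite ler_pdivlMr// ler_piMr// expR_ge0.
Qed.

Lemma sep_gen_axis n (z : hplane R) : hx z = 0 -> hy z = (rate S n)^-1 ->
  sep z (hact (gen S n) z) =
  (dil S n - 4) ^+ 2 + (4 * dil S n) ^+ 2.
Proof.
move=> x0 y0; have [e1 e2] := hact_coord (gen S n) z.
have c0 := lt0r_neq0 (rate_gt0 S n).
rewrite /sep e1 e2 /cnorm x0 y0; have [-> -> -> ->] := genE S n.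
by field.
Qed.

(** At height 1 / c_n with a_n < 2, the n-th generator moves the point of the
ray by the separation (a_n - 4)^2 + (4 a_n)^2 < 9 + 64. *)
Lemma ray_inj_radius_up_i : (ray_inj_radius (tpi up_i) < +oo)%E.
Proof.
apply: (@le_lt_trans _ _ (arcosh (1 + 73 / 2))%:E); last exact: ltry.
rewrite /ray_inj_radius limf_einfE; apply: ge_ereal_sup => _ [V [A [_ AV]] <-].
pose r : R := Num.min 1 (expR (- A)).
have r0 : 0 < r by rewrite lt_min ltr01 expR_gt0.
have [n [an cn]] := dense (lexx 1) r0.
have c0 := rate_gt0 S n; pose t := - ln (rate S n).
have At : A < t.
  rewrite /t ltrNr -[- A]expRK ltr_ln ?posrE ?expR_gt0//.
  by apply: lt_le_trans cn _; rewrite ge_min lexx orbT.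
apply: le_trans (_ : inj_radius (base_point (geodesic_flow t (tpi up_i))) <= _)%E.
  by apply: ereal_inf_lbound; exists t => //; exact: AV.
rewrite geodesic_flow_up_i /tpi base_point_pi; set z := foot _.
apply: le_trans (_ : (hdist z (hact (gen S n) z))%:E <= _)%E.
  apply: ereal_inf_lbound; exists z, (gen S n); split=> //.
  - exact: schottky_gen.
  - by move=> e; have := genE S n; rewrite e; have [_ _ -> _] := @SL2_1E R;
      case=> _ _ cE; move: c0; rewrite -cE ltxx.
  - move=> e; have := genE S n; rewrite e; have [_ _ -> _] := SL2_oppE (1%g : SL2 R).
    have [_ _ -> _] := @SL2_1E R.
    by case=> _ _ cE; move: c0; rewrite -cE oppr0 ltxx.
have zy : hy z = (rate S n)^-1 by rewrite /hy /= expRN lnK.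
rewrite lee_fin hdist_sep sep_gen_axis//.
have a1 := dil_gt1 S n.
have a2 : dil S n < 2.
  have : `|1 - dil S n| < 1 by apply: lt_le_trans an _; rewrite ge_min lexx.
  by rewrite ltr_norml => /andP[]; lra.
by apply: le_arcosh; clear -a1 a2; nra.
Qed.

(** With l slightly larger than 1, the image of the upward vector at i l^2 is
near u and in the closure of its horocycle. On the horocycle it would come from
an element of the group with |d| = 1 / l < 1. *)
Lemma not_locally_closed_up_i : ~ locally_closed_orbit (tpi up_i).
Proof.
move=> [V Vu Vc].
have : nbhs (tact 1%g up_i) (tpi @^-1` V) by rewrite tact1; exact: tpi_nbhs.
move=> /tact_up_i_near[r r0 hr].
pose d := Num.min r 1 / 2; pose l : R := 1 + d.
have d0 : 0 < d by rewrite divr_gt0// lt_min r0 ltr01.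
have dr : d < r.
  rewrite /d ltr_pdivrMr//; apply: (@le_lt_trans _ _ r); first by rewrite ge_min lexx.
  by rewrite ltr_pMr// ltr1n.
have l1 : 1 < l by rewrite ltrDl.
have l0 : 0 < l by rewrite (lt_trans ltr01).
have lV : l^-1 < 1 by rewrite invf_lt1.
have ll : l * l^-1 = 1 by rewrite divff// gt_eqF.
pose t := ln (l ^+ 2).
have et : expR t = l ^+ 2 by rewrite lnK// posrE exprn_gt0.
have t0 : 0 <= t by rewrite ln_ge0// exprn_ege1// ltW.
have gt : up 0 (expR_gt0 t) = tact (dilation l0) up_i.
  by rewrite (tact_dilation l0 (expR_gt0 t)).
have Vt : V (tpi (up 0 (expR_gt0 t))).
  have [h1 h2 h3 h4] := SL2_ofE (dilation_subproof l0).
  have [k1 k2 k3 k4] := @SL2_1E R.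
  rewrite gt; apply: hr; rewrite ?h1 ?h2 ?h3 ?h4 ?k1 ?k2 ?k3 ?k4.
  - by rewrite /l opprD addrA subrr sub0r normrN gtr0_norm.
  - by rewrite subrr normr0.
  - by rewrite subrr normr0.
  - rewrite ger0_norm; last by rewrite subr_ge0 ltW.
    apply: lt_trans dr; rewrite /l in l1 lV ll *.
    by move: ((1 + d)^-1) lV ll => x x1 ?; nra.
have Ct : closure (horocycle_orbit (tpi up_i)) (tpi (up 0 (expR_gt0 t))).
  by apply: geodesic_ray_closure; exists t => //; rewrite geodesic_flow_up_i.
suff Ot : ~ horocycle_orbit (tpi up_i) (tpi (up 0 (expR_gt0 t))).
  have : (set0 : set (unit_tangent G)) (tpi (up 0 (expR_gt0 t))) by rewrite -Vc.
  by [].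
move=> [s _]; rewrite horocycle_flow_up_i gt -tact_shear.
move=> /(@eqmodP _ (tangent_rel G))/asboolP[M GM]; rewrite -tactM => E.
have {E} : [/\ ec (M * shear s)%g = 0 & `|ed (M * shear s)%g| = l^-1].
  have [h1 h2 h3 h4] := SL2_ofE (dilation_subproof l0).
  have lVp : `|l^-1| = l^-1 by rewrite gtr0_norm// invr_gt0.
  have [<-|] := tact_up_inj E; first by rewrite h3 h4.
  move=> /(congr1 (@SL2_opp R)); rewrite SL2_oppK => <-.
  have [_ _ -> ->] := SL2_oppE (dilation l0).
  by rewrite h3 h4 oppr0 normrN.
have [_ _ -> ->] := SL2_mulE M (shear s).
have [-> -> -> ->] := SL2_ofE (shear_subproof s).
rewrite mulr1 mulr0 addr0 mulr1 => -[-> h]; move: h; rewrite mul0r add0r => h.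
have := schottky_ed_ge1 GM; rewrite h; lra.
Qed.

End vertical_ray.

(** * Choice of the parameters *)
Section dense_dilations_exist.
Context {R : realType}.

(** Each rate is the preceding one times a factor that makes both conditions
hold for consecutive indices; the sequence being decreasing, they propagate to
all pairs. *)
Lemma exists_rates (a : nat -> R) : (forall n, 1 < a n) ->
  exists c : nat -> R, [/\ forall n, 0 < c n,
    forall m n, (m < n)%N -> 2 * (a m + 7) * c n <= c m,
    forall m n, (m < n)%N -> (a m + 5) * c n <= (a n - 1) * c m &
    forall n, c n <= n.+1%:R^-1].
Proof.
move=> a1.
pose th n := Num.min (2 * (a n + 7))^-1 ((a n.+1 - 1) / (a n + 5)).
pose c := fix c n := if n is k.+1 then c k * th k else 1.
have th0 n : 0 < th n.
  rewrite lt_min invr_gt0 divr_gt0 ?andbT ?subr_gt0//; have := a1 n; lra.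
have th1 n : 2 * (a n + 7) * th n <= 1.
  have := a1 n => an; rewrite -ler_pdivlMl ?mulr1; last by lra.
  by rewrite ge_min lexx.
have th2 n : (a n + 5) * th n <= a n.+1 - 1.
  have := a1 n => an; rewrite -ler_pdivlMl ?[_^-1 * _]mulrC; last by lra.
  by rewrite ge_min lexx orbT.
have c0 n : 0 < c n by elim: n => //= n IH; rewrite mulr_gt0.
have cS n : 2 * (a n + 7) * c n.+1 <= c n.
  have -> : 2 * (a n + 7) * c n.+1 = c n * (2 * (a n + 7) * th n).
    by rewrite /=; ring.
  by rewrite ler_piMr// ltW.
have cS1 n : 16 * c n.+1 <= c n.
  by apply: le_trans (cS n); rewrite ler_pM2r//; have := a1 n; lra.
have dec m n : (m <= n)%N -> c n <= c m.
  elim: n => [|n IH]; first by rewrite leqn0 => /eqP ->.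
  rewrite leq_eqVlt => /orP[/eqP ->//|/IH]; apply: le_trans.
  by have := cS1 n; have := c0 n.+1; lra.
have sep m n : (m < n)%N -> 2 * (a m + 7) * c n <= c m.
  move=> /dec mn; apply: le_trans (cS m); rewrite ler_pM2l//.
  by have := a1 m; lra.
exists c; split=> //.
  move=> m [//|n]; rewrite ltnS leq_eqVlt => /orP[/eqP ->|mn].
    have -> : (a n + 5) * c n.+1 = c n * ((a n + 5) * th n) by rewrite /=; ring.
    by rewrite mulrC ler_pM2r.
  have h1 : c n.+1 <= (a n.+1 - 1) * c n.
    rewrite /= mulrC ler_pM2r//; apply: le_trans (th2 n).
    by rewrite ler_peMl ?(ltW (th0 n))//; have := a1 n; lra.
  have h2 : (a m + 5) * c n <= c m.
    by apply: le_trans (sep m n mn); rewrite ler_pM2r//; have := a1 m; lra.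
  have am : 0 < a m + 5 by have := a1 m; lra.
  apply: (@le_trans _ _ ((a m + 5) * ((a n.+1 - 1) * c n))).
    by rewrite ler_pM2l.
  by rewrite mulrCA ler_pM2l// subr_gt0.
elim=> [|n IH]; first by rewrite invr1.
have x1 : 1 <= n.+1%:R :> R by rewrite ler1n.
have := IH; rewrite -div1r ler_pdivlMr; last by lra.
rewrite -[n.+2%:R]natr1 -div1r ler_pdivlMr; last by lra.
have := cS1 n; have := c0 n.+1; have := c0 n.
by move: (c n.+1) (c n) (n.+1%:R) x1 => v u x x1 u0 v0 vu ux; nra.
Qed.

(** For n = 2^k (2 i + 1) this is 1 + (i + 1) / (k + 1): every fraction of this
form is reached, and a fine denominator forces a large index. *)
Definition dense_dil (n : nat) : R :=
  1 + (n %/ 2 ^ logn 2 n)./2.+1%:R / (logn 2 n).+1%:R.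

Lemma dense_dil_gt1 n : 1 < dense_dil n.
Proof. by rewrite ltrDl divr_gt0// ltr0n. Qed.

Lemma dense_dilP (lam r : R) N : 1 <= lam -> 0 < r ->
  exists2 n, (N <= n)%N & `|lam - dense_dil n| < r.
Proof.
move=> lam1 r0.
pose k := (N + Num.truncn r^-1)%N.
have kr : k.+1%:R^-1 < r.
  rewrite invf_plt ?posrE ?ltr0n//.
  have /truncn_itv/andP[_ h] : 0 <= r^-1 by rewrite invr_ge0 ltW.
  by apply: (lt_le_trans h); rewrite ler_nat ltnS leq_addl.
(* (i + 1) / (k + 1) is the next fraction above lam - 1. *)
pose i := Num.truncn ((lam - 1) * k.+1%:R).
have /truncn_itv/andP[i1 i2] : 0 <= (lam - 1) * k.+1%:R :> R.
  by rewrite mulr_ge0// subr_ge0.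
exists (2 ^ k * i.*2.+1)%N.
  apply: leq_trans (leq_pmulr _ _) => //; apply: leq_trans (ltnW (ltn_expl k _)) => //.
  exact: leq_addr.
have logk : logn 2 (2 ^ k * i.*2.+1) = k.
  rewrite lognM ?expn_gt0// lognX logn_prime// eqxx muln1.
  by rewrite lognE /= dvdn2 /= odd_double addn0.
rewrite /dense_dil logk mulKn ?expn_gt0// -[i.*2.+1]add1n halfD /= odd_double /=.
rewrite add0n doubleK.
apply: le_lt_trans kr.
have k0 : 0 < k.+1%:R :> R by rewrite ltr0n.
rewrite add0n -natr1; move: i1 i2; rewrite -/i -[i.+1%:R]natr1.
move: (k.+1%:R) k0 (i%:R) => x x0 y y1 y2.
have -> : lam - (1 + (y + 1) / x) = ((lam - 1) * x - y - 1) * x^-1.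
  by field; rewrite gt_eqF.
rewrite normrM (gtr0_norm (_ : 0 < x^-1)) ?invr_gt0//.
apply: ler_piMl; first by rewrite invr_ge0 ltW.
by rewrite ler_norml; apply/andP; split; lra.
Qed.

Lemma exists_dense_schottky : exists S : schottky R, dense_dilations S.
Proof.
have [c [c0 sep cdil crate]] := exists_rates dense_dil_gt1.
exists (Schottky dense_dil_gt1 c0 sep cdil) => lam r lam1 r0.
have [n Nn nr] := dense_dilP (Num.truncn r^-1) lam1 r0.
exists n; split=> //=; apply: le_lt_trans (crate n) _.
rewrite invf_plt ?posrE ?ltr0n//.
have /truncn_itv/andP[_ h] : 0 <= r^-1 by rewrite invr_ge0 ltW.
by apply: (lt_le_trans h); rewrite ler_nat ltnS.
Qed.

End dense_dilations_exist.

Theorem theorem1p3 (R : realType) :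
  exists G : surface_group R,
    [/\ geometrically_infinite G,
        exists2 C : R, 0 < C & forall p : surface G, (C%:E <= inj_radius p)%E &
        exists u : unit_tangent G,
          [/\ nonwandering u,
              almost_minimizing u,
              geodesic_ray u `<=` closure (horocycle_orbit u),
              (ray_inj_radius u < +oo)%E &
              ~ locally_closed_orbit u]].
Proof.
have [S dense] := @exists_dense_schottky R.
exists (schottky_group S); split.
- exact: schottky_geometrically_infinite.
- exact: schottky_inj_radius.
exists (tpi S up_i); split.
- exact: nonwandering_up_i.
- exact: almost_minimizing_up_i.
- exact: geodesic_ray_closure.
- exact: ray_inj_radius_up_i.
- exact: not_locally_closed_up_i.
Qed.
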